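(* For a fixed positive integer $B$, one iteration of the Random Quadratic Frobenius Test on an odd integer $n>1$ has running time of at most $3$ selfridges.
   Context: Cost model: an algorithm with input $n$ has running time of $k$ selfridges if it can be completed in the time it takes to perform $(k+o(1))\log_2 n$ multiplications modulo $n$, where computing an inverse modulo $n$ and computing a Jacobi symbol $\left(\frac{\cdot}{n}\right)$ each count as $O(1)$ multiplications, an addition modulo $n$ counts as $o(1)$ multiplications, and $O(1)$, $o(1)$ refer to $n\to\infty$. Quadratic Frobenius Test (QFT): let $n>1$ be odd and $b,c$ integers with $\left(\frac{b^2+4c}{n}\right)=-1$ and $\left(\frac{-c}{n}\right)=1$; in $R=(\mathbb{Z}/n\mathbb{Z})[x]/(x^2-bx-c)$: (1) if $n$ is divisible by a prime $\le\min\{B,\sqrt n\}$, declare composite and stop; (2) if $\sqrt n\in\mathbb{Z}$, declare composite and stop; (3) if $x^{(n+1)/2}\notin\mathbb{Z}/n\mathbb{Z}$ in $R$, declare composite and stop; (4) if $x^{n+1}\neq -c$ in $R$, declare composite and stop; (5) writing $n^2-1=2^rs$ with $s$ odd, if $x^s\ne 1$ and $x^{2^js}\ne -1$ in $R$ for all $0\le j\le r-2$, declare composite and stop; otherwise declare probable prime. One iteration of the Random Quadratic Frobenius Test (RQFT) on odd $n>1$: (1) choose pairs $(b,c)$ at random with $1\le b,c<n$ until one is found with $\left(\frac{b^2+4c}{n}\right)=-1$ and $\left(\frac{-c}{n}\right)=1$, or with $\gcd(b^2+4c,n)$, $\gcd(b,n)$ or $\gcd(c,n)$ a nontrivial divisor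 of $n$; if the latter occurs first, declare $n$ composite and stop; if after $B$ pairs none satisfying these conditions is found, declare $n$ a probable prime and stop; (2) perform the QFT with parameters $(b,c)$. *)

(* Defs.v *)
From HB Require Import structures.
From mathcomp Require Import all_boot all_order all_algebra.
From mathcomp Require Import all_classical all_reals all_analysis.

Set Implicit Arguments.
Unset Strict Implicit.
Unset Printing Implicit Defensive.

Import Order.TTheory GRing.Theory Num.Theory.
Import numFieldNormedType.Exports.

Local Open Scope classical_set_scope.
Local Open Scope ring_scope.

Definition legendre_symbol (a : int) (p : nat) : int :=
  if (p%:Z %| a)%Z then 0
  else if [exists x : 'I_p, (x%:Z ^+ 2 == a %[mod p%:Z])%Z] then 1 else -1.

Definition jacobi_symbol (a : int) (n : nat) : int :=
  \prod_(p <- primes n) legendre_symbol a p ^+ logn p n.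

Variant verdict := Composite | ProbablePrime.

Section QuadraticFrobeniusTest.
Variables (B n b c : nat).

Definition qft_poly : {poly 'Z_n} := 'X^2 - b%:R *: 'X - c%:R%:P.

(* [{poly %/ h}] is the quotient of the polynomial ring by a monic h of positive
   degree, and ['qX] is the class of the indeterminate. *)
Definition qft_ring := {poly %/ qft_poly}.

Definition qft_x : qft_ring := 'qX.

Definition qft_r : nat := logn 2 (n ^ 2 - 1)%N.
Definition qft_s : nat := ((n ^ 2 - 1) %/ 2 ^ qft_r)%N.

Definition qft : verdict :=
  if [exists p : 'I_B.+1, [&& prime p, (p %| n)%N & (p ^ 2 <= n)%N]]
  then Composite
  else if [exists m : 'I_n.+1, (m ^ 2)%N == n]
  then Composite
  else if ~~ [exists a : 'Z_n, qft_x ^+ (n.+1 %/ 2)%N == a%:A]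
  then Composite
  else if qft_x ^+ n.+1 != - c%:R
  then Composite
  else if (qft_x ^+ qft_s != 1) &&
          [forall j : 'I_qft_r.-1, qft_x ^+ (2 ^ j * qft_s)%N != -1]
  then Composite
  else ProbablePrime.

Definition qft_admissible : bool :=
  (jacobi_symbol (b ^ 2 + 4 * c)%N%:Z n == -1) &&
  (jacobi_symbol (- c%:Z) n == 1).

Definition nontrivial_gcd (a : nat) : bool := (1 < gcdn a n < n)%N.

Definition reveals_factor : bool :=
  [|| nontrivial_gcd (b ^ 2 + 4 * c)%N, nontrivial_gcd b | nontrivial_gcd c].

End QuadraticFrobeniusTest.

(* The random choices are a stream [w] of elements of [1, n-1]; the i-th random
   pair is (w (2i), w (2i+1)). *)
Definition random_tape (n : nat) (w : nat -> nat) : Prop :=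
  forall i, (1 <= w i < n)%N.

(* [k] is the number of pairs that may still be drawn, [i] the index of the next
   one.  A divisor terminates the search only if it is found strictly before an
   admissible pair, so admissibility is examined first. *)
Fixpoint rqft_search (B n : nat) (w : nat -> nat) (k i : nat) : verdict :=
  if k is k'.+1 then
    let b := w (2 * i)%N in
    let c := w (2 * i).+1 in
    if qft_admissible n b c then qft B n b c
    else if reveals_factor n b c then Composite
    else rqft_search B n w k' i.+1
  else ProbablePrime.

Definition rqft (B n : nat) (w : nat -> nat) : verdict :=
  rqft_search B n w B 0.

(* Algorithms are programs of a random-access machine working modulo n: one
   finite program serves all inputs n.  Every register and every array cell
   contains a natural number below n, representing a residue class.  The
   program has access to n only through the arithmetic modulo n (for instance
   n - 1 is [Sub] of 0 and 1). *)
Inductive instr :=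
| Const (d k : nat)
| Add (d s t : nat)
| Sub (d s t : nat)
| Mul (d s t : nat)
| Inv (d s : nat)
| Jac (d s : nat)
| Half (d s : nat)
| Rand (d : nat)
| Read (d a i : nat)
| Write (a i s : nat).

Inductive test := TestEq (s t : nat) | TestLt (s t : nat).

Inductive prog :=
| Skip
| Do (i : instr)
| Seq (p q : prog)
| If (t : test) (p q : prog)
| While (t : test) (p : prog).

Record state := State {
  reg : nat -> nat;
  arr : nat -> nat -> nat;
  pos : nat   (* number of elements of the random tape already read *)
}.

Definition init_state : state := State (fun=> 0%N) (fun _ _ => 0%N) 0.

Definition update (T : Type) (f : nat -> T) (i : nat) (v : T) : nat -> T :=
  fun j => if j == i then v else f j.

Definition set_reg (st : state) (d v : nat) : state :=
  State (update (reg st) d v) (arr st) (pos st).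

Definition set_arr (st : state) (a i v : nat) : state :=
  let row := update (arr st a) i v in
  State (reg st) (update (arr st) a row) (pos st).

(* The representative in [0, n-1] of the inverse of [v] modulo [n], and 0 if
   there is none. *)
Definition inv_mod (n v : nat) : nat :=
  if [pick u : 'I_n | (v * u == 1 %[mod n])%N] is Some u then u else 0%N.

Definition residue (z : int) (n : nat) : nat := `|(z %% n%:Z)%Z|%N.

Definition run_instr (n : nat) (w : nat -> nat) (i : instr) (st : state) :
    state :=
  let r := reg st in
  match i with
  | Const d k => set_reg st d (k %% n)%N
  | Add d s t => set_reg st d ((r s + r t) %% n)%N
  | Sub d s t => set_reg st d (residue ((r s)%:Z - (r t)%:Z) n)
  | Mul d s t => set_reg st d ((r s * r t) %% n)%N
  | Inv d s => set_reg st d (inv_mod n (r s))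
  | Jac d s => set_reg st d (residue (jacobi_symbol (r s)%:Z n) n)
  | Half d s => set_reg st d (r s)./2
  | Rand d => State (update r d (w (pos st))) (arr st) (pos st).+1
  | Read d a i => set_reg st d (arr st a (r i))
  | Write a i s => set_arr st a (r i) (r s)
  end.

Definition run_test (t : test) (st : state) : bool :=
  match t with
  | TestEq s t => reg st s == reg st t
  | TestLt s t => (reg st s < reg st t)%N
  end.

(* Operations as they are charged for. *)
Variant op := OpMul | OpInv | OpJac | OpRand | OpAdd.

(* Loading a constant, halving, comparing and copying numbers below n take time
   linear in the bit length of n, like an addition modulo n, and are charged as
   such; so is every evaluation of a test. *)
Definition instr_op (i : instr) : op :=
  match i with
  | Mul _ _ _ => OpMul
  | Inv _ _ => OpInv
  | Jac _ _ => OpJac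
  | Rand _ => OpRand
  | Const _ _ | Add _ _ _ | Sub _ _ _ | Half _ _ | Read _ _ _ | Write _ _ _ =>
      OpAdd
  end.

(* [exec n w p st tr st']: on input n with random tape w, the program p started
   in state st terminates in state st' after the sequence of operations tr. *)
Inductive exec (n : nat) (w : nat -> nat) :
    prog -> state -> seq op -> state -> Prop :=
| ExecSkip st : exec n w Skip st [::] st
| ExecDo i st : exec n w (Do i) st [:: instr_op i] (run_instr n w i st)
| ExecSeq p q st1 st2 st3 tr1 tr2 :
    exec n w p st1 tr1 st2 -> exec n w q st2 tr2 st3 ->
    exec n w (Seq p q) st1 (tr1 ++ tr2) st3
| ExecIf t p q st st' tr :
    exec n w (if run_test t st then p else q) st tr st' ->
    exec n w (If t p q) st (OpAdd :: tr) st'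
| ExecWhileFalse t p st :
    run_test t st = false -> exec n w (While t p) st [:: OpAdd] st
| ExecWhileTrue t p st1 st2 st3 tr1 tr2 :
    run_test t st1 = true ->
    exec n w p st1 tr1 st2 -> exec n w (While t p) st2 tr2 st3 ->
    exec n w (While t p) st1 (OpAdd :: tr1 ++ tr2) st3.

Definition verdict_code (v : verdict) : nat :=
  if v is ProbablePrime then 1%N else 0%N.

(* The verdict is left in register 0. *)
Definition implements (p : prog) (f : nat -> (nat -> nat) -> verdict) : Prop :=
  forall n w, odd n -> (1 < n)%N -> random_tape n w ->
    exists tr st, exec n w p init_state tr st /\
      reg st 0%N = verdict_code (f n w).

(* [price o n] is the time of one operation o modulo n, the unit of time being
   one multiplication modulo n. *)
Definition cost_model (R : realType) (price : op -> nat -> R) : Prop :=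
  [/\ forall o n, 0 <= price o n,
      forall n, price OpMul n = 1,
      (price OpInv : nat -> R^o) =O_\oo (fun=> 1 : R^o),
      (price OpJac : nat -> R^o) =O_\oo (fun=> 1 : R^o) &
      (price OpRand : nat -> R^o) =O_\oo (fun=> 1 : R^o) /\
      (price OpAdd : nat -> R^o) =o_\oo (fun=> 1 : R^o)].

Definition cost (R : realType) (price : op -> nat -> R) (n : nat)
    (tr : seq op) : R :=
  \sum_(o <- tr) price o n.

Definition log2 (R : realType) (x : R) : R := ln x / ln 2.

(* Running time of at most [k] selfridges; the bound concerns the worst case
   over the random choices. *)
Definition at_most_selfridges (R : realType) (price : op -> nat -> R)
    (f : nat -> (nat -> nat) -> verdict) (k : R) : Prop :=
  exists2 p : prog, implements p f &
  exists2 e : nat -> R^o, e =o_\oo (fun=> 1 : R^o) &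
    forall n w tr st, odd n -> (1 < n)%N -> random_tape n w ->
      exec n w p init_state tr st ->
      cost price n tr <= (k + e n) * log2 n%:R.

(* Main.v *)
(** With d = 2x - b one has d^2 = b^2 + 4c, and a power x^j = u + v d is stored
    as (u, v) together with its norm u^2 - (b^2 + 4c) v^2 = (-c)^j.  Because
    (u + v d)^2 = (2 u^2 - norm) + 2 u v d, a squaring costs three
    multiplications modulo n.

    Let m be the even one of (n - 1)/2 and (n + 1)/2, and m = 2^t (2k + 1).  The
    digits of k are processed from the top, one squaring for each; the digits not
    yet accounted for form a small exponent acc, and x^acc is multiplied in from a
    table only when acc reaches a bound H of order log log n.  This leaves
    O(log n / log H) multiplications that are not squarings.  One then passes to
    x^(2k + 1) and squares t times, which gives x^m and hence x^((n + 1)/2) and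
    x^(n + 1).

    The last step of the test comes for free.  Once x^(n + 1) = -c is known, for
    n = 1 mod 4 the element x^(2^(i + 1) s) is the norm of x^(2^i (2k + 1)), and
    for n = 3 mod 4 it equals -1 iff x^(2^i (2k + 1)) has coordinate u = 0; these
    data occur during the t squarings.  Finally x^s is determined by
    x^((n + 1)/2), (-c)^k and x^(2k + 1).

    The perfect square step never triggers: the Jacobi symbol modulo a square is
    not -1.  A prime p divides n iff p has no inverse modulo n. *)
Require Import Defs.
From mathcomp Require Import all_boot all_order all_algebra.
From mathcomp Require Import all_classical all_reals all_analysis.
From mathcomp Require Import zify ring lra.

Set Implicit Arguments.
Unset Strict Implicit.
Unset Printing Implicit Defensive.

Import Order.TTheory GRing.Theory Num.Theory.
Import Defs.

Local Open Scope ring_scope.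

(** * The quotient ring *)

Section QuotientRing.
Variables (n b c : nat).
Hypothesis n_gt1 : (1 < n)%N.
Let h := qft_poly n b c.
Let A := qft_ring n b c.

Lemma qft_poly_lower_size : (size (- (b%:R *: 'X) - c%:R%:P : {poly 'Z_n})%R <= 2)%N.
Proof.
rewrite (leq_trans (size_polyD _ _)) // !size_polyN geq_max.
rewrite (leq_trans (size_scale_leq _ _)) ?size_polyX //.
by rewrite (leq_trans (size_polyC_leq1 _)).
Qed.

Lemma size_qft_poly : size h = 3.
Proof.
rewrite /h /qft_poly -addrA size_polyDl ?size_polyXn //.
by rewrite ltnS qft_poly_lower_size.
Qed.

Lemma monic_qft_poly : h \is monic.
Proof.
rewrite monicE /h /qft_poly -addrA lead_coefDl ?lead_coefXn //.
by rewrite size_polyXn ltnS qft_poly_lower_size.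
Qed.

Lemma mk_monic_qft_poly : mk_monic h = h.
Proof. by rewrite /mk_monic size_qft_poly monic_qft_poly. Qed.

Lemma qft_natr0 : n%:R = 0 :> A.
Proof. by rewrite -(scaler_nat (R := 'Z_n)) pchar_Zp // scale0r. Qed.

Lemma qft_scalarE (a : 'Z_n) : a%:A = (a : nat)%:R :> A.
Proof. by rewrite -{1}(natr_Zp a) scaler_nat. Qed.

Lemma qft_x_sqr : qft_x n b c ^+ 2 = b%:R * qft_x n b c + c%:R.
Proof.
pose phi : {rmorphism {poly 'Z_n} -> A} := in_qpoly h.
have hE : phi h = 0.
  apply: val_inj => /=; rewrite mk_monic_qft_poly.
  by rewrite Pdiv.RingMonic.rmodpp // monic_qft_poly.
have X2 : 'X^2 = h + ('X *+ b + 1 *+ c).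
  rewrite /h /qft_poly scaler_nat polyC_natr; ring.
have xE : qft_x n b c = phi 'X by [].
rewrite xE -rmorphXn X2 rmorphD hE add0r rmorphD /= !rmorphMn rmorph1.
by rewrite mulr_natl.
Qed.

(** A polynomial of degree below 2 is its own remainder modulo the monic quadratic, which makes 1
    and [x] independent over Z/n. The coefficients are natural numbers because they will come from
    registers. *)
Lemma qft_basis (u v : nat) :
  u%:R + v%:R * qft_x n b c = 0 -> (n %| u)%N && (n %| v)%N.
Proof.
pose phi : {rmorphism {poly 'Z_n} -> A} := in_qpoly h.
have xE : qft_x n b c = phi 'X by [].
have -> : u%:R + v%:R * qft_x n b c = phi (u%:R%:P + v%:R *: 'X).
  by rewrite scaler_nat polyC_natr xE rmorphD /= !rmorphMn rmorph1 mulr_natl.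
move=> /(congr1 val) /=.
have sz : (size (u%:R%:P + v%:R *: 'X : {poly 'Z_n})%R < size h)%N.
  rewrite size_qft_poly (leq_ltn_trans (size_polyD _ _)) // gtn_max.
  by rewrite (leq_ltn_trans (size_polyC_leq1 _)) // (leq_ltn_trans (size_scale_leq _
    _)) // size_polyX.
rewrite mk_monic_qft_poly Pdiv.CommonRing.rmodp_small // => E.
have Zn (k : nat) : (k%:R == 0 :> 'Z_n) = (n %| k)%N.
  by rewrite -(inj_eq val_inj) /= Zp_nat /= Zp_cast.
rewrite -!Zn; apply/andP; split; apply/eqP.
  by move: (congr1 (fun p : {poly _} => p`_0) E);
    rewrite coefD coefC coefZ coefX mulr0 addr0 coef0.
by move: (congr1 (fun p : {poly _} => p`_1) E);
  rewrite coefD coefC coefZ coefX mulr1 add0r coef0.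
Qed.

End QuotientRing.

(** * Coordinates with respect to 1 and the square root of the discriminant *)

Section Coordinates.
Variables (A : comNzRingType) (b c : nat) (x : A).
Hypothesis x_sqr : x ^+ 2 = b%:R * x + c%:R.

Definition sqrt_disc : A := 2 * x - b%:R.
Let d := sqrt_disc.
Let D : A := (b ^ 2 + 4 * c)%N%:R.

Lemma sqrt_disc_sqr : d ^+ 2 = D.
Proof.
rewrite /d /D /sqrt_disc natrD natrX natrM.
by rewrite sqrrB exprMn x_sqr; ring.
Qed.

(* The third coordinate is the norm of x ^+ j; carrying it along is what makes
   a squaring cost three multiplications. *)
Definition represents (u v m j : nat) : Prop :=
  [/\ u%:R + v%:R * d = x ^+ j, m%:R = (- c%:R) ^+ j :> A &
      u%:R ^+ 2 - D * v%:R ^+ 2 = m%:R].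

Lemma represents0 u v m :
  u%:R = 1 :> A -> v%:R = 0 :> A -> m%:R = 1 :> A -> represents u v m 0.
Proof. by move=> hu hv hm; split; rewrite ?hu ?hv ?hm ?expr0; ring. Qed.

(** With [h] the inverse of 2, x = h b + h d, whose norm is h^2 (b^2 - (b^2 + 4 c)) = - c. *)
Lemma represents1 (h : nat) u v m : 2 * h%:R = 1 :> A ->
  u%:R = h%:R * b%:R :> A -> v%:R = h%:R :> A -> m%:R = - c%:R :> A ->
  represents u v m 1.
Proof.
move=> h2 hu hv hm; split; rewrite ?hu ?hv ?hm ?expr1 //.
  transitivity (2 * h%:R * x : A); last by rewrite h2 mul1r.
  by rewrite /d /sqrt_disc; ring.
rewrite /D natrD natrX natrM; transitivity (- (2 * h%:R) ^+ 2 * c%:R : A);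
  first by ring.
by rewrite h2; ring.
Qed.

Lemma represents_sqr u v m j u' v' m' : represents u v m j ->
  u'%:R = u%:R * u%:R + u%:R * u%:R - m%:R :> A ->
  v'%:R = u%:R * v%:R + u%:R * v%:R :> A ->
  m'%:R = m%:R * m%:R :> A -> represents u' v' m' (2 * j).
Proof.
move=> [e1 e2 e3] hu hv hm; split.
- rewrite hu hv mulnC exprM -e1 -e3 sqrrD exprMn sqrt_disc_sqr; ring.
- by rewrite hm e2 mulnC exprM expr2.
- by rewrite hu hv hm -e3; ring.
Qed.

(** The norm clause is Brahmagupta's identity: u^2 - D v^2 is multiplicative. *)
Lemma represents_mul u1 v1 m1 j1 u2 v2 m2 j2 u v m :
  represents u1 v1 m1 j1 -> represents u2 v2 m2 j2 ->
  u%:R = u1%:R * u2%:R + D * (v1%:R * v2%:R) :> A ->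
  v%:R = u1%:R * v2%:R + v1%:R * u2%:R :> A ->
  m%:R = m1%:R * m2%:R :> A -> represents u v m (j1 + j2).
Proof.
move=> [e1 e2 e3] [f1 f2 f3] hu hv hm; split.
- by rewrite hu hv exprD -e1 -f1 -sqrt_disc_sqr; ring.
- by rewrite hm e2 f2 exprD.
- by rewrite hu hv hm -e3 -f3; ring.
Qed.

Variable n : nat.
Hypotheses (n_odd : odd n) (n0 : n%:R = 0 :> A).
Hypothesis basis : forall u v : nat,
  u%:R + v%:R * x = 0 -> (n %| u)%N && (n %| v)%N.

Lemma natr_mod u : (u %% n)%N%:R = u%:R :> A.
Proof. by rewrite {2}(divn_eq u n) natrD natrM n0 mulr0 add0r. Qed.

(** The difference of the two numbers is divisible by n and below n. This is what lets a comparison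
    of registers decide an equality of scalars in the ring. *)
Lemma natr_inj (u v : nat) : (u < n)%N -> (v < n)%N -> u%:R = v%:R :> A -> u = v.
Proof.
have le_case u' v' : (u' <= v')%N -> (v' < n)%N -> u'%:R = v'%:R :> A -> u' = v'.
  move=> le_uv lt_vn e.
  have /andP[] : (n %| v' - u')%N && (n %| 0)%N.
    by apply: basis; rewrite mul0r addr0 natrB // e subrr.
  case: (posnP (v' - u')) => [|lt_uv]; first by lia.
  by rewrite gtnNdvd //; lia.
move=> un vn; case: (leqP u v) => [|/ltnW] le_uv e; first exact: le_case.
by apply/esym/le_case.
Qed.

(** Substituting d = 2 x - b gives a relation between 1 and [x] in which [x] has coefficient 2 v;
    since n is odd, n divides v. *)
Lemma coord_eq (u v w : nat) : (v < n)%N ->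
  u%:R + v%:R * d = w%:R -> v = 0.
Proof.
move=> vn e.
(* The factor [n.-1] plays the role of -1, so that the constant coefficient u - (b v + w) is a
   natural number. *)
have /andP[_] : (n %| u + n.-1 * (b * v + w))%N && (n %| 2 * v)%N.
  apply: basis; have n1 : n.-1%:R = -1 :> A.
    by apply/eqP; rewrite -subr_eq0 opprK natr1 prednK ?n0 // odd_gt0.
  rewrite natrD [(n.-1 * _)%N%:R]natrM n1 natrD !natrM -e /d /sqrt_disc; ring.
rewrite Gauss_dvdr ?coprimen2 //; case: (posnP v) => // v_gt0.
by rewrite gtnNdvd.
Qed.
End Coordinates.

(** Here n^2 - 1 = 2 m * 2 (m + 1), and m + 1 is odd because m is even. *)
Lemma qft_exponent1 n m t s : n = (2 * m).+1 -> m = (2 ^ t * s)%N -> odd s ->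
  (0 < t)%N -> qft_r n = t.+2 /\ qft_s n = (s * m.+1)%N.
Proof.
move=> nE mE s_odd t_gt0.
have m_even : ~~ odd m by rewrite mE oddM oddX negb_and; case: t t_gt0 {mE}.
have E : (n ^ 2 - 1 = 2 ^ t.+2 * (s * m.+1))%N.
  by rewrite nE mulnA !expnS -!mulnA (mulnA _ s) -mE; lia.
have h_odd : odd (s * m.+1) by rewrite oddM s_odd /=.
have r_eq : qft_r n = t.+2.
  rewrite /qft_r E lognM ?expn_gt0 ?(odd_gt0 h_odd) // pfactorK //.
  by rewrite (@logn_coprime 2) ?addn0 // coprime2n.
by split=> //; rewrite /qft_s r_eq E mulKn ?expn_gt0.
Qed.

(** Here n^2 - 1 = 2 m * 2 (m - 1), and m - 1 is odd because m is even. *)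
Lemma qft_exponent3 n m t s : n.+1 = (2 * m)%N -> m = (2 ^ t * s)%N -> odd s ->
  (0 < t)%N -> qft_r n = t.+2 /\ qft_s n = (s * m.-1)%N.
Proof.
move=> nE mE s_odd t_gt0.
have m_even : ~~ odd m by rewrite mE oddM oddX negb_and; case: t t_gt0 {mE}.
have m_gt0 : (0 < m)%N by lia.
have m1_odd : odd m.-1 by rewrite -subn1 oddB // addbT.
have E : (n ^ 2 - 1 = 2 ^ t.+2 * (s * m.-1))%N.
  rewrite mulnA !expnS -!mulnA (mulnA _ s) -mE.
  have -> : n = (2 * m).-1 by rewrite -nE.
  by case: (m) m_gt0 => // m' _; nia.
have h_odd : odd (s * m.-1) by rewrite oddM s_odd /=.
have r_eq : qft_r n = t.+2.
  rewrite /qft_r E lognM ?expn_gt0 ?(odd_gt0 h_odd) // pfactorK //.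
  by rewrite (@logn_coprime 2) ?addn0 // coprime2n.
by split=> //; rewrite /qft_s r_eq E mulKn ?expn_gt0.
Qed.

Lemma coprime_inverse n v : (1 < n)%N -> coprime v n ->
  exists2 u, (u < n)%N & (v * u == 1 %[mod n])%N.
Proof.
move=> n_gt1 co; have [v0|v_gt0] := posnP v; first by move: co;
  rewrite v0 /coprime gcd0n => /eqP; lia.
case: (egcdnP n v_gt0) => u w E _; exists (u %% n)%N; first by rewrite ltn_mod ltnW.
by rewrite modnMmr mulnC E (eqP co) modnMDl.
Qed.

(** * The verdict of the test in terms of the power with exponent (n + 1) / 2 *)

Section Verdict.
Variables (B n b c : nat).
Hypotheses (n_odd : odd n) (n_gt1 : (1 < n)%N).

Let A : comNzRingType := qft_ring n b c.
Let x : A := qft_x n b c.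
Let x_sqr : x ^+ 2 = b%:R * x + c%:R := qft_x_sqr n b c.
Let n0 : n%:R = 0 :> A := qft_natr0 b c n_gt1.
Let basis := qft_basis n_gt1 (b := b) (c := c).

Definition small_factor : bool :=
  [exists p : 'I_B.+1, [&& prime p, (p %| n)%N & (p ^ 2 <= n)%N]].

(** The half power u + v d is a scalar iff v = 0, and then x^(n + 1) = u^2; so steps (3) and (4)
    become tests on its coordinates. *)
Lemma qft_split (u v m : nat) :
  ~~ [exists m : 'I_n.+1, (m ^ 2)%N == n] -> (u < n)%N -> (v < n)%N ->
  represents b c x u v m n.+1./2 ->
  qft B n b c =
    if [|| small_factor, v != 0%N, u%:R * u%:R != - c%:R :> A |
        (x ^+ qft_s n != 1) &&
        [forall j : 'I_(qft_r n).-1, x ^+ (2 ^ j * qft_s n)%N != -1]]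
    then Composite else ProbablePrime.
Proof.
move=> n_nonsquare un vn [rep _ _]; rewrite /qft -/small_factor (negPf n_nonsquare).
case: small_factor => //=; rewrite divn2.
have -> : [exists a : 'Z_n, qft_x n b c ^+ n.+1./2 == a%:A] = (v == 0%N).
  apply/existsP/eqP => [[a /eqP e]|v0].
    apply: (coord_eq n_odd n0 basis vn (b := b) (u := u) (w := a)).
    by rewrite rep -qft_scalarE.
  by exists (u%:R : 'Z_n); rewrite -/x -rep v0 mul0r addr0 scaler_nat.
case: eqP => //= v0.
have -> : qft_x n b c ^+ n.+1 = u%:R * u%:R :> A.
  rewrite -/x -{1}(odd_double_half n.+1) /= n_odd add0n -muln2 exprM -rep v0.
  by rewrite mul0r addr0 expr2.
by case: ifP => //= _; case: ifP.
Qed.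

Let half1 m : n = (2 * m).+1 -> n.+1./2 = m.+1.
Proof. by move=> ->; lia. Qed.

(** The odd part of n^2 - 1 is (2 k + 1) (m + 1) with m + 1 = (n + 1) / 2. Hence x^s = a^(2 k + 1) =
    a (-c)^k, and x^(2^(i + 1) s) = (a^2)^(2^i (2 k + 1)) is a power of -c. *)
Lemma qft_final1 (m t k : nat) (a : nat) :
  n = (2 * m).+1 -> m = (2 ^ t * (2 * k).+1)%N -> (0 < t)%N ->
  x ^+ n.+1./2 = a%:R -> a%:R * a%:R = - c%:R :> A ->
  (x ^+ qft_s n != 1) &&
    [forall j : 'I_(qft_r n).-1, x ^+ (2 ^ j * qft_s n)%N != -1] =
  ~~ [|| a%:R * (- c%:R) ^+ k == 1 :> A, a%:R * (- c%:R) ^+ k == -1 :> A |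
      [exists i : 'I_t, (- c%:R : A) ^+ (2 ^ i * (2 * k).+1) == -1]].
Proof.
move=> nE mE t_gt0 xa aa.
have s_odd : odd (2 * k).+1 by lia.
have [-> ->] := qft_exponent1 nE mE s_odd t_gt0.
have xs : x ^+ ((2 * k).+1 * m.+1) = a%:R * (- c%:R) ^+ k.
  by rewrite mulnC exprM -(half1 nE) xa -aa exprS exprM expr2.
have xs2 i : x ^+ (2 ^ i.+1 * ((2 * k).+1 * m.+1)) = (- c%:R) ^+ (2 ^ i * (2 * k).+1).
  have -> : (2 ^ i.+1 * ((2 * k).+1 * m.+1) = (m.+1 * 2) * (2 ^ i * (2 * k).+1))%N.
    by rewrite expnS; lia.
  by rewrite exprM (exprM x m.+1 2) -(half1 nE) xa expr2 aa.
rewrite negb_or xs; congr (_ && _).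
(* The t + 1 indices j split into j = 0, a test on a (-c)^k, and j = i + 1 with i < t. *)
apply/forallP/idP => [H|/norP[h0 /existsPn h1] [[|i] /= it]].
- rewrite negb_or -xs -[X in x ^+ X]mul1n (H (Ordinal (ltn0Sn t))).
  apply/existsPn => i; rewrite -xs2; exact: (H (lift ord0 i)).
- by rewrite mul1n xs.
by rewrite xs2; apply: (h1 (Ordinal (it : (i < t)%N))).
Qed.

Hypothesis c_coprime : coprime c n.

(** Since x (x - b) = c is invertible modulo n, [x] is a unit. *)
Lemma qft_x_cancel j (p q : A) : x ^+ j * p = x ^+ j * q -> p = q.
Proof.
have [ci _ /eqP cci] := coprime_inverse n_gt1 c_coprime.
have ciE : c%:R * ci%:R = 1 :> A.
  by rewrite -natrM -(natr_mod n0) cci (natr_mod n0).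
have xiE : ci%:R * (x - b%:R) * x = 1.
  transitivity (ci%:R * (x ^+ 2 - b%:R * x)); first by ring.
  by rewrite x_sqr addrAC subrr add0r mulrC.
have xj : (ci%:R * (x - b%:R)) ^+ j * x ^+ j = 1.
  by rewrite -exprMn xiE expr1n.
by move=> e; rewrite -[p]mul1r -xj -mulrA e mulrA xj mul1r.
Qed.

(** The trace of x^j is 2 u, so x^(2 j) = 2 u x^j - (-c)^j; both 2 and x^j are invertible. *)
Lemma represents_trace0 u v m j : (u < n)%N -> represents b c x u v m j ->
  (u == 0%N) = (x ^+ (2 * j) == - (- c%:R) ^+ j).
Proof.
move=> un [r1 r2 r3].
have e2 : x ^+ (2 * j) = x ^+ j * (u%:R * 2) - (- c%:R) ^+ j.
  by rewrite mulnC exprM -r1 -r2 -r3 sqrrD exprMn -(sqrt_disc_sqr x_sqr); ring.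
rewrite e2 -subr_eq0 opprK subrK; apply/eqP/eqP => [->|]; first by rewrite mul0r mulr0.
rewrite -[0](mulr0 (x ^+ j)) => /qft_x_cancel u0.
(* As n is odd, (n + 1) / 2 is the inverse of 2. *)
have h2 : n.+1./2%:R * 2 = 1 :> A.
  rewrite -natrM muln2 (_ : n.+1./2.*2 = n.+1); last by lia.
  by rewrite -natr1 n0 add0r.
apply: (natr_inj n_odd basis) => //; first exact: odd_gt0.
transitivity (u%:R * 2 * n.+1./2%:R : A); last by rewrite u0 mul0r.
by rewrite -mulrA [2 * _]mulrC h2 mulr1.
Qed.

(** Now s is (2 k + 1) (m - 1) with m = (n + 1) / 2, so x^(2 k + 1) x^s = a^(2 k + 1) = a (-c)^k. In
    the same way x^(2^(i + 1) s) is known after multiplication by x^(2^(i + 1) (2 k + 1)), and units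
    cancel. *)
Lemma qft_final3 (m t k : nat) (a : nat) :
  n.+1 = (2 * m)%N -> m = (2 ^ t * (2 * k).+1)%N -> (0 < t)%N ->
  x ^+ n.+1./2 = a%:R -> a%:R * a%:R = - c%:R :> A ->
  (x ^+ qft_s n != 1) &&
    [forall j : 'I_(qft_r n).-1, x ^+ (2 ^ j * qft_s n)%N != -1] =
  ~~ [|| a%:R * (- c%:R) ^+ k == x ^+ (2 * k).+1,
         a%:R * (- c%:R) ^+ k == - x ^+ (2 * k).+1 |
         [exists i : 'I_t, x ^+ (2 * (2 ^ i * (2 * k).+1)) ==
                           - (- c%:R) ^+ (2 ^ i * (2 * k).+1)]].
Proof.
move=> nE mE t_gt0 xa aa.
have s_odd : odd (2 * k).+1 by lia.
have [-> ->] := qft_exponent3 nE mE s_odd t_gt0.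
set s' := (2 * k).+1 in s_odd mE *.
have mxa : x ^+ m = a%:R by rewrite -xa; congr (_ ^+ _); lia.
have m_gt0 : (0 < m)%N by lia.
have xs : x ^+ s' * x ^+ (s' * m.-1) = a%:R * (- c%:R) ^+ k.
  by rewrite -exprD -mulnS prednK // mulnC exprM mxa -aa /s' exprS exprM expr2.
have xs2 i : x ^+ (2 * (2 ^ i * s')) * x ^+ (2 ^ i.+1 * (s' * m.-1)) =
             (- c%:R) ^+ (2 ^ i * s').
  rewrite mulnA -expnS -exprD mulnA -mulnS prednK // mulnC exprM mxa expnS -mulnA.
  by rewrite exprM expr2 aa.
have cond0 e : (x ^+ (s' * m.-1) == e) = (a%:R * (- c%:R) ^+ k == x ^+ s' * e).
  by rewrite -xs; apply/eqP/eqP => [-> //|]; apply: qft_x_cancel.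
have condS i : (x ^+ (2 ^ i.+1 * (s' * m.-1)) == -1) =
               (x ^+ (2 * (2 ^ i * s')) == - (- c%:R) ^+ (2 ^ i * s')).
  rewrite -xs2; apply/eqP/eqP => [->|e]; first by rewrite mulrN1 opprK.
  by apply: (@qft_x_cancel (2 * (2 ^ i * s'))); rewrite mulrN1 {2}e opprK.
rewrite negb_or cond0 mulr1; congr (_ && _).
apply/forallP/idP => [H|/norP[h0 /existsPn h1] [[|i] /= it]].
- have := H (Ordinal (ltn0Sn t)); rewrite /= mul1n cond0 mulrN1 negb_or => -> /=.
  by apply/existsPn => i; rewrite -condS; apply: (H (lift ord0 i)).
- by rewrite mul1n cond0 mulrN1.
by rewrite condS; apply: (h1 (Ordinal (it : (i < t)%N))).
Qed.

End Verdict.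

(** * Jacobi symbols *)

Lemma legendre_symbol_mod (a b : int) p : (a == b %[mod p%:Z])%Z ->
  legendre_symbol a p = legendre_symbol b p.
Proof.
move=> /eqP e; rewrite /legendre_symbol !(sameP dvdz_mod0P eqP) e.
by case: ifP => // _; rewrite (eq_existsb (fun x : 'I_p => _ == (b %% p%:Z)%Z)) ?e.
Qed.

Lemma legendre_symbol_val a p : legendre_symbol a p \in [:: -1; 0; 1].
Proof. by rewrite /legendre_symbol; do 2?case: ifP. Qed.

(** Every prime in the product divides n. The lemma is needed because [Jac] is applied to reduced
    arguments. *)
Lemma jacobi_symbol_mod (a b : int) n : (a == b %[mod n%:Z])%Z ->
  jacobi_symbol a n = jacobi_symbol b n.
Proof.
rewrite eqz_mod_dvd => dv; rewrite /jacobi_symbol !big_seq; apply: eq_bigr => p.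
rewrite mem_primes => /and3P[_ _ pn]; congr (_ ^+ _); apply: legendre_symbol_mod.
by rewrite eqz_mod_dvd; apply: dvdz_trans dv; rewrite dvdzE.
Qed.

Lemma jacobi_symbol_val a n : jacobi_symbol a n \in [:: -1; 0; 1].
Proof.
have mul_cl (y z : int) : y \in [:: -1; 0; 1] -> z \in [:: -1; 0; 1] ->
    y * z \in [:: -1; 0; 1].
  by rewrite !inE => /or3P[]/eqP-> /or3P[]/eqP->.
rewrite /jacobi_symbol; elim/big_ind: _ => // p _.
by elim: (logn p n) => [|e IH]; rewrite ?expr0 // exprS; apply: mul_cl => //;
  apply: legendre_symbol_val.
Qed.

Lemma jacobi_symbolN1_nonsquare a n : jacobi_symbol a n = -1 ->
  ~~ [exists m : 'I_n.+1, (m ^ 2)%N == n].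
Proof.
move=> ja; apply/existsP => -[m /eqP mn].
suff : 0 <= jacobi_symbol a n by rewrite ja.
(* In a square every prime has an even exponent, so each factor of the symbol is nonnegative. *)
apply: prodr_ge0 => p _; by rewrite -mn lognX mulnC exprM exprn_even_ge0.
Qed.

(** A common prime factor contributes a Legendre symbol 0 with positive exponent. Applied to -c,
    this makes c invertible for admissible pairs. *)
Lemma jacobi_symbol_coprime a n : (0 < n)%N -> jacobi_symbol a n != 0 ->
  coprime `|a|%N n.
Proof.
move=> n_gt0; apply: contraR => not_co.
have g_gt1 : (1 < gcdn `|a| n)%N.
  by have : (0 < gcdn `|a| n)%N by [rewrite gcdn_gt0 n_gt0 orbT]; move: not_co;
    rewrite /coprime; lia.
have p_prime := pdiv_prime g_gt1; have := pdiv_dvd (gcdn `|a| n).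
set p := pdiv _ in p_prime *; rewrite dvdn_gcd => /andP[pa pn].
have pP : p \in primes n by rewrite mem_primes p_prime n_gt0.
rewrite /jacobi_symbol (big_rem p pP) /= /legendre_symbol ifT; last by rewrite dvdzE.
by rewrite expr0n -leqn0 leqNgt logn_gt0 pP mul0r.
Qed.

(** * Reasoning about executions *)

Definition is_mul o := if o is OpMul then true else false.
Definition is_add o := if o is OpAdd then true else false.
(** The operations of price O(1): inverses, Jacobi symbols and random draws. *)
Definition is_call o := ~~ (is_mul o || is_add o).

Definition muls (tr : seq op) := count is_mul tr.
Definition adds (tr : seq op) := count is_add tr.
Definition calls (tr : seq op) := count is_call tr.

Definition dest (i : instr) : option nat :=
  match i with
  | Const d _ | Add d _ _ | Sub d _ _ | Mul d _ _ | Inv d _ | Jac d _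
  | Half d _ | Rand d | Read d _ _ => Some d
  | Write _ _ _ => None
  end.

Definition dest_arr (i : instr) : option nat :=
  if i is Write a _ _ then Some a else None.

Fixpoint instrs_of (p : prog) : seq instr :=
  match p with
  | Skip => [::]
  | Do i => [:: i]
  | Seq p q | If _ p q => instrs_of p ++ instrs_of q
  | While _ p => instrs_of p
  end.

Definition written p := pmap dest (instrs_of p).
Definition written_arr p := pmap dest_arr (instrs_of p).

(** A frame condition read off from the syntax of [p]. Arrays are tracked as a whole, not cell by
    cell. *)
Definition same_outside p (st st' : state) : Prop :=
  (forall r, r \notin written p -> reg st' r = reg st r) /\
  (forall a, a \notin written_arr p -> arr st' a = arr st a).

Definition bounded n (st : state) : Prop :=
  (forall r, (reg st r < n)%N) /\ (forall a i, (arr st a i < n)%N).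

Definition instrs (s : seq instr) : prog := foldr (fun i p => Seq (Do i) p) Skip s.

Arguments instrs : simpl never.

Section Execution.
Variables (n : nat) (w : nat -> nat).

Lemma exec_same_outside p st tr st' :
  exec n w p st tr st' -> same_outside p st st'.
Proof.
elim=> {p st tr st'}.
- by [].
- move=> i st; split=> r; rewrite /written /written_arr.
    by case: i => /= >; rewrite ?inE /update //= => /negPf ->.
  by case: i => /= >; rewrite ?inE /update //= => /negPf ->.
- move=> p q st1 st2 st3 tr1 tr2 _ [h1 g1] _ [h2 g2].
  split=> r; rewrite /written /written_arr /= pmap_cat mem_cat negb_or => /andP[rp rq].
    by rewrite h2 ?h1.
  by rewrite g2 ?g1.
- move=> t p q st st' tr _ [h g].
  split=> r; rewrite /written /written_arr /= pmap_cat mem_cat negb_or => /andP[rp rq].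
    by apply: h; case: ifP.
  by apply: g; case: ifP.
- by [].
- move=> t p st1 st2 st3 tr1 tr2 _ _ [h1 g1] _ [h2 g2].
  by split=> r rp; [rewrite h2 ?h1 | rewrite g2 ?g1].
Qed.

Hypotheses (n_gt1 : (1 < n)%N) (w_tape : random_tape n w).

Lemma residue_lt z : (residue z n < n)%N.
Proof.
rewrite /residue -ltz_nat gez0_abs ?modz_ge0 ?ltz_pmod //; lia.
Qed.

Lemma inv_mod_lt v : (inv_mod n v < n)%N.
Proof. by rewrite /inv_mod; case: pickP => [u _|_]; [apply: ltn_ord | apply: ltnW]. Qed.

Lemma exec_bounded p st tr st' :
  exec n w p st tr st' -> bounded n st -> bounded n st'.
Proof.
have n_gt0 := ltnW n_gt1.
have upd f i v : (forall r, f r < n)%N -> (v < n)%N -> (forall r, update f i v r < n)%N.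
  by move=> fn vn r; rewrite /update; case: ifP.
elim=> {p st tr st'}.
- by [].
- move=> i st [hr ha]; case: i => [d k|d s t|d s t|d s t|d s|d s|d s|d|d a i|a i s];
    split => //=; try (apply: upd => //; rewrite ?ltn_mod ?residue_lt ?inv_mod_lt //).
  + by rewrite (leq_ltn_trans _ (hr s)) // leq_half_double; lia.
  + by case/andP: (w_tape (pos st)).
  + by move=> a'; rewrite /update; case: ifP => // _; apply: upd.
- by move=> p q st1 st2 st3 tr1 tr2 _ h1 _ h2 /h1/h2.
- by [].
- by [].
- by move=> t p st1 st2 st3 tr1 tr2 _ _ h1 _ h2 /h1/h2.
Qed.

(** The specifications construct one execution, whereas the running time bound quantifies over all
    of them; determinism closes the gap. *)
Lemma exec_det p st tr1 st1 : exec n w p st tr1 st1 ->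
  forall tr2 st2, exec n w p st tr2 st2 -> tr1 = tr2 /\ st1 = st2.
Proof.
elim=> {p st tr1 st1} >; intros.
all: match goal with H : exec _ _ _ _ ?tr ?st |- _ = ?tr /\ _ => inversion H; subst end.
all: try congruence.
all: repeat match goal with
  IH : forall tr st, exec _ _ ?p ?s tr st -> _, H : exec _ _ ?p ?s _ _ |- _ =>
    have [? ?] := IH _ _ H; subst; clear H
  end.
all: by [].
Qed.

(** Total correctness: termination is part of the statement, and the postcondition also sees the
    trace, so correctness and cost are proved together. *)
Definition wp p st (Q : state -> seq op -> Prop) : Prop :=
  exists tr st', exec n w p st tr st' /\ Q st' tr.

Lemma wp_mono p st (Q Q' : state -> seq op -> Prop) :
  (forall st' tr, exec n w p st tr st' -> Q st' tr -> Q' st' tr) ->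
  wp p st Q -> wp p st Q'.
Proof. by move=> QQ' [tr [st' [e q]]]; exists tr, st'; split => //; apply: QQ'. Qed.

Lemma wp_seq p q st Q :
  wp p st (fun st1 tr1 => wp q st1 (fun st2 tr2 => Q st2 (tr1 ++ tr2))) ->
  wp (Seq p q) st Q.
Proof.
move=> [tr1 [st1 [e1 [tr2 [st2 [e2 h]]]]]].
by exists (tr1 ++ tr2), st2; split => //; apply: ExecSeq e1 e2.
Qed.

Lemma wp_if t p q st (Q : state -> seq op -> Prop) :
  (run_test t st = true -> wp p st (fun st' tr => Q st' (OpAdd :: tr))) ->
  (run_test t st = false -> wp q st (fun st' tr => Q st' (OpAdd :: tr))) ->
  wp (If t p q) st Q.
Proof.
case E: (run_test t st) => h1 h2.
  have [//|tr [st' [e h]]] := h1 _; exists (OpAdd :: tr), st'; split => //.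
  by apply: ExecIf; rewrite E.
have [//|tr [st' [e h]]] := h2 _; exists (OpAdd :: tr), st'; split => //.
by apply: ExecIf; rewrite E.
Qed.

Definition run_instrs (s : seq instr) (st : state) : state :=
  foldl (fun st i => run_instr n w i st) st s.

Lemma wp_instrs s st (Q : state -> seq op -> Prop) :
  Q (run_instrs s st) (map instr_op s) -> wp (instrs s) st Q.
Proof.
move=> h; exists (map instr_op s), (run_instrs s st); split => // {h}.
elim: s st => [|i s IH] st /=; first exact: ExecSkip.
by rewrite -cat1s; apply: ExecSeq (ExecDo _ _ _ _) (IH _).
Qed.

Lemma wp_skip st (Q : state -> seq op -> Prop) : Q st [::] -> wp Skip st Q.
Proof. by move=> h; exists [::], st; split => //; apply: ExecSkip. Qed.

(** The invariant speaks of the trace since the start of the loop, and [mu] decreases to give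
    termination. The last [OpAdd] is the failing test. *)
Lemma wp_while t p st0 (I : state -> seq op -> Prop) (mu : state -> nat) :
  bounded n st0 -> I st0 [::] ->
  (forall st tr, bounded n st -> same_outside p st0 st -> I st tr ->
     run_test t st = true ->
     wp p st (fun st' tr' => I st' (tr ++ OpAdd :: tr') /\ (mu st' < mu st)%N)) ->
  wp (While t p) st0 (fun st' tr' =>
    exists2 tr, I st' tr & run_test t st' = false /\ tr' = tr ++ [:: OpAdd]).
Proof.
move=> bd0 I0 step.
(* Generalization to a loop already under way, with [tr] behind it, by induction on a bound [N] for
   the measure. *)
suff loop N st tr : (mu st < N)%N -> bounded n st -> same_outside p st0 st -> I st tr ->
    wp (While t p) st (fun st' tr' =>
      exists2 tr0, I st' tr0 & run_test t st' = false /\ tr ++ tr' = tr0 ++ [:: OpAdd]).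
  by have := loop _ _ [::] (ltnSn _) bd0 _ I0; apply; split.
elim: N st tr => // N IH st tr muN bd out Ist.
case E: (run_test t st); last first.
  exists [:: OpAdd], st; split; first exact: ExecWhileFalse.
  by exists tr.
have [tr1 [st1 [e1 [I1 mu1]]]] := step _ _ bd out Ist E.
have bd1 := exec_bounded e1 bd.
have [h1 g1] := exec_same_outside e1.
have out1 : same_outside p st0 st1.
  by case: out => h g; split=> r rp; [rewrite h1 ?h | rewrite g1 ?g].
have [tr2 [st2 [e2 [tr0 It0 [tf trE]]]]] := IH _ _ (leq_trans mu1 muN) bd1 out1 I1.
exists (OpAdd :: tr1 ++ tr2), st2; split; first exact: ExecWhileTrue E e1 e2.
by exists tr0 => //; split => //; rewrite -trE -catA.
Qed.

Lemma wp_loop t p st0 (I Q : state -> seq op -> Prop) (mu : state -> nat) :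
  bounded n st0 -> I st0 [::] ->
  (forall st tr, bounded n st -> same_outside p st0 st -> I st tr ->
     run_test t st = true ->
     wp p st (fun st' tr' => I st' (tr ++ OpAdd :: tr') /\ (mu st' < mu st)%N)) ->
  (forall st tr, bounded n st -> same_outside p st0 st -> I st tr ->
     run_test t st = false -> Q st (tr ++ [:: OpAdd])) ->
  wp (While t p) st0 Q.
Proof.
move=> bd0 I0 step last; apply: wp_mono (wp_while bd0 I0 step).
move=> st' tr e [tr0 It [tf ->]]; apply: last => //; first exact: exec_bounded e bd0.
by have := exec_same_outside e; rewrite /same_outside /written /written_arr.
Qed.

Lemma run_instrs_reg s st r :
  r \notin pmap dest s -> reg (run_instrs s st) r = reg st r.
Proof.
elim: s st => //= i s IH st rs; rewrite IH; last by move: rs; case: (dest i) => //= d;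
  rewrite inE negb_or => /andP[].
by move: rs; case: i => /= >; rewrite ?inE ?negb_or /update //= => /andP[/negPf ->].
Qed.

Lemma run_instrs_bounded s st : bounded n st -> bounded n (run_instrs s st).
Proof.
by elim: s st => //= i s IH st bd; apply: IH; apply: exec_bounded bd; apply: ExecDo.
Qed.

End Execution.

Definition cost_le (tr : seq op) (m o a : nat) : Prop :=
  [/\ (muls tr <= m)%N, (calls tr <= o)%N & (adds tr <= a)%N].

(** Counts are additive over concatenation, so cost goals reduce to linear arithmetic. *)
Ltac costs :=
  intros;
  repeat match goal with H : cost_le _ _ _ _ |- _ =>
    let h1 := fresh in let h2 := fresh in let h3 := fresh in
    case: H => [h1 h2 h3] end;
  unfold muls, calls, adds in *; split; unfold muls, calls, adds;
  simpl; repeat progress (rewrite ?count_cat; simpl); lia.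

(* [rU + rV d] with norm [rW] is the current power and [rU2 + rV2 d] with norm
   [rW2] the second factor of a product; [rM] is the even number m, then its odd
   part; [rT] is t; [rL] is the number of digits of k; [rType] is 0 iff n = 1
   mod 4; [rNk] is (-c)^k; [rUs + rVs d] is x^(2k+1).  While a pair (b, c) is being
   chosen, [rM], [rT] and [rL] hold inverses. *)
Local Notation rVerdict := 0%N (only parsing).
Local Notation rB := 1%N (only parsing).
Local Notation rC := 2%N (only parsing).
Local Notation rNorm := 3%N (only parsing).
Local Notation rDisc := 4%N (only parsing).
Local Notation rA := 5%N (only parsing).
Local Notation rE := 6%N (only parsing).
Local Notation rZero := 7%N (only parsing).
Local Notation rOne := 8%N (only parsing).
Local Notation rMinusOne := 9%N (only parsing).
Local Notation rHalf := 10%N (only parsing).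
Local Notation rHalfB := 11%N (only parsing).
Local Notation rM := 12%N (only parsing).
Local Notation rT := 13%N (only parsing).
Local Notation rL := 14%N (only parsing).
Local Notation rH := 15%N (only parsing).
Local Notation rQ := 16%N (only parsing).
Local Notation rAcc := 17%N (only parsing).
Local Notation rU := 18%N (only parsing).
Local Notation rV := 19%N (only parsing).
Local Notation rW := 20%N (only parsing).
Local Notation rType := 21%N (only parsing).
Local Notation rFlag := 22%N (only parsing).
Local Notation rNk := 23%N (only parsing).
Local Notation rUs := 24%N (only parsing).
Local Notation rVs := 25%N (only parsing).
Local Notation rNeg := 26%N (only parsing).
Local Notation rSmall := 27%N (only parsing).
Local Notation rU2 := 30%N (only parsing).
Local Notation rV2 := 31%N (only parsing).
Local Notation rW2 := 32%N (only parsing).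

(** * The program *)

(** Parity is tested by comparing m with twice its half. Adding [rZero] serves as the copy
    instruction. *)
Definition split_even : prog :=
  Seq (instrs [:: Half rE rM; Add rA rE rE])
    (While (TestEq rA rM)
      (instrs [:: Add rM rE rZero; Add rT rT rOne; Half rE rM; Add rA rE rE])).

(** The digits of [rE] go to array 0, least significant first, and [rL] counts them. *)
Definition bits : prog :=
  Seq (instrs [:: Add rM rE rZero; Const rL 0])
    (While (TestLt rZero rM)
      (instrs [:: Half rE rM; Add rA rE rE; Sub rA rM rA; Write 0 rL rA;
                  Add rL rL rOne; Add rM rE rZero])).

(** The sum of [rL] and [rT] is of order log n. One more than the bit length of this sum minus 1 is
    the threshold H, of order log log n. *)
Definition bit_length : prog :=
  Seq (instrs [:: Const rH 1; Add rQ rL rT; Sub rQ rQ rOne])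
    (While (TestLt rZero rQ) (instrs [:: Half rQ rQ; Add rH rH rOne])).

Lemma residue_subn n a b : (b <= a)%N -> (a < n)%N ->
  residue (a%:Z - b%:Z) n = (a - b)%N.
Proof.
move=> ba an; rewrite /residue subzn // modz_small //; lia.
Qed.

(** * Integer preprocessing: odd part, binary digits, bit length *)

Section Loops.
Variables (n : nat) (w : nat -> nat).
Hypotheses (n_odd : odd n) (n_gt1 : (1 < n)%N) (w_tape : random_tape n w).

Lemma split_even_spec st : bounded n st ->
  reg st rZero = 0%N -> reg st rOne = 1%N -> reg st rT = 0%N -> (0 < reg st rM)%N ->
  wp n w split_even st (fun st' tr =>
    [/\ reg st rM = (2 ^ reg st' rT * reg st' rM)%N, odd (reg st' rM),
        reg st' rE = (reg st' rM)./2 &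
        cost_le tr 0 0 (5 * reg st' rT + 3)]).
Proof.
move=> bd z0 o1 t0 m_gt0; apply: wp_seq; apply: wp_instrs.
have := bd.1 rM; move: m_gt0; set m0 := reg st rM => m_gt0 m0n.
set st1 := run_instrs _ _ _ st.
apply: (@wp_loop n w n_gt1 w_tape _ _ st1 (fun st' tr =>
    [/\ m0 = (2 ^ reg st' rT * reg st' rM)%N, reg st' rE = (reg st' rM)./2,
        reg st' rA = (reg st' rM)./2.*2 &
        cost_le tr 0 0 (5 * reg st' rT)]) _ (fun st => reg st rM)).
- exact: run_instrs_bounded.
- rewrite /st1 /= /update /= t0 addnn mul1n; split=> //.
  by rewrite modn_small // (leq_ltn_trans _ m0n) // -/m0; lia.
- move=> st' tr bd' out [mE eE aE cE] /eqP /= test.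
  have z' : reg st' rZero = 0%N by rewrite out.1.
  have o' : reg st' rOne = 1%N by rewrite out.1.
  have m'n := bd'.1 rM.
  have m'0 : (0 < reg st' rM)%N by move: m_gt0; rewrite mE; case: (reg st' rM);
    rewrite ?muln0.
  (* The counter does not wrap around modulo n: the remaining factor is even and positive, hence at
     least 2, and t + 1 <= 2^t * 2 <= m. *)
  have t'n : ((reg st' rT).+1 < n)%N.
    apply: leq_ltn_trans m0n; rewrite mE.
    have : (reg st' rT < 2 ^ reg st' rT)%N by apply: ltn_expl.
    have : (2 <= reg st' rM)%N by lia.
    by nia.
  apply: wp_instrs; rewrite /= /update /= z' o' addn0 addn1 eE addnn.
  rewrite (modn_small t'n) !(@modn_small (reg st' rM)./2) ?(@modn_small (_./2.*2));
    try lia.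
  split; last by lia.
  split=> //; last by costs.
  by rewrite mE expnS; lia.
move=> st' tr bd' out [mE eE aE cE] /eqP /= test.
split=> //; last by costs.
by lia.
Qed.

Lemma bits_spec st : bounded n st -> reg st rZero = 0%N -> reg st rOne = 1%N ->
  let k := reg st rE in
  wp n w bits st (fun st' tr =>
    [/\ (k < 2 ^ reg st' rL)%N, (0 < k)%N -> (2 ^ (reg st' rL).-1 <= k)%N, k = 0%N ->
      reg st' rL = 0%N,
        forall i, (i < reg st' rL)%N -> arr st' 0 i = odd (k %/ 2 ^ i)%N :> nat &
        cost_le tr 0 0 (7 * reg st' rL + 3)]).
Proof.
move=> bd z0 o1; have := bd.1 rE; set k := reg st rE => kn /=.
apply: wp_seq; apply: wp_instrs; set st1 := run_instrs _ _ _ st.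
apply: (@wp_loop n w n_gt1 w_tape _ _ st1 (fun st' tr =>
    [/\ reg st' rM = (k %/ 2 ^ reg st' rL)%N,
        (0 < reg st' rL)%N -> (2 ^ (reg st' rL).-1 <= k)%N,
        forall i, (i < reg st' rL)%N -> arr st' 0 i = odd (k %/ 2 ^ i)%N :> nat &
        cost_le tr 0 0 (7 * reg st' rL)]) _ (fun st => reg st rM)).
- exact: run_instrs_bounded.
- rewrite /st1 /= /update /= z0 addn0 mod0n expn0 divn1; split=> //.
  by rewrite modn_small.
- move=> st' tr bd' out [mE lE aE cE] /= test.
  have z' : reg st' rZero = 0%N by rewrite out.1.
  have o' : reg st' rOne = 1%N by rewrite out.1.
  have m'n := bd'.1 rM; rewrite z' in test.
  have Lk : (2 ^ reg st' rL <= k)%N by move: test; rewrite mE divn_gt0 // expn_gt0.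
  have l'n : ((reg st' rL).+1 < n)%N.
    by apply: leq_ltn_trans kn; apply: leq_trans Lk; apply: ltn_expl.
  apply: wp_instrs; rewrite /= /update /= z' o' addn0 addn1 addnn.
  rewrite (modn_small l'n) !(@modn_small (reg st' rM)./2) ?(@modn_small (_./2.*2));
    try lia.
  rewrite residue_subn; [|lia|lia].
  split; last by lia.
  split=> //; last by costs.
  + by rewrite expnSr divnMA -mE divn2.
  + move=> i; rewrite ltnS leq_eqVlt; case: eqVneq => [-> _|ne /= il];
    last by rewrite aE.
    by rewrite -mE; lia.
move=> st' tr bd' out [mE lE aE cE] /= test.
have z' : reg st' rZero = 0%N by rewrite out.1.
have k2 : (k < 2 ^ reg st' rL)%N.
  by move: test; rewrite z' mE divn_gt0 ?expn_gt0 // leqNgt => /negbFE.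
split=> //; last by costs.
- by move=> k0; apply: lE; case: (reg st' rL) k2; lia.
- by move=> k0; apply/eqP; rewrite -leqn0 leqNgt; apply/negP => /lE;
  rewrite k0 leqn0 expn_eq0.
Qed.

Lemma bit_length_spec st : bounded n st -> reg st rZero = 0%N -> reg st rOne = 1%N ->
  let q := (reg st rL + reg st rT - 1)%N in (0 < reg st rL + reg st rT < n)%N ->
  wp n w bit_length st (fun st' tr =>
    [/\ (q < 2 ^ (reg st' rH).-1)%N, (0 < q)%N -> (2 ^ (reg st' rH).-2 <= q)%N,
        (0 < reg st' rH <= q.+1)%N &
        cost_le tr 0 0 (3 * reg st' rH + 4)]).
Proof.
move=> bd z0 o1 q /andP[q_gt0 qn].
apply: wp_seq; apply: wp_instrs; set st1 := run_instrs _ _ _ st.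
apply: (@wp_loop n w n_gt1 w_tape _ _ st1 (fun st' tr =>
    [/\ reg st' rQ = (q %/ 2 ^ (reg st' rH).-1)%N, (0 < reg st' rH <= q.+1)%N,
        (1 < reg st' rH)%N -> (2 ^ (reg st' rH).-2 <= q)%N &
        cost_le tr 0 0 (3 * reg st' rH)]) _ (fun st => reg st rQ)).
- exact: run_instrs_bounded.
- rewrite /st1 /= /update /= (modn_small n_gt1) expn0 divn1; split=> //.
  by rewrite o1 (modn_small qn) residue_subn.
- move=> st' tr bd' out [qE /andP[h_gt0 hq] hE cE] /= test.
  have z' : reg st' rZero = 0%N by rewrite out.1.
  have o' : reg st' rOne = 1%N by rewrite out.1.
  rewrite z' in test.
  have Hq : (2 ^ (reg st' rH).-1 <= q)%N by move: test; rewrite qE divn_gt0 // expn_gt0.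
  have Hq' : (reg st' rH <= q)%N.
    by apply: leq_trans Hq; rewrite -{1}(prednK h_gt0); apply: ltn_expl.
  apply: wp_instrs; rewrite /= /update /= o' addn1 modn_small;
    last by rewrite /q in Hq'; lia.
  split; last by lia.
  split=> //; last by costs.
  by rewrite -divn2 qE -divnMA -expnSr prednK.
move=> st' tr bd' out [qE /andP[h_gt0 hq] hE cE] /= test.
have z' : reg st' rZero = 0%N by rewrite out.1.
have k2 : (q < 2 ^ (reg st' rH).-1)%N.
  by move: test; rewrite z' qE divn_gt0 ?expn_gt0 // leqNgt => /negbFE.
split=> //; [|by rewrite h_gt0|by costs].
move=> q1_gt0; apply: hE; rewrite ltn_neqAle h_gt0 andbT; apply/eqP => h1.
by move: k2; rewrite -h1 expn0; lia.
Qed.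
End Loops.

Definition sqr : prog := instrs
  [:: Mul rA rU rU; Mul rE rU rV; Add rA rA rA; Sub rU rA rW; Add rV rE rE;
      Mul rW rW rW].

(** Six multiplications, one of them by the discriminant. [rNeg] is scratch space here, and [rU] is
    overwritten only after its last use. *)
Definition mul : prog := instrs
  [:: Mul rA rU rU2; Mul rE rV rV2; Mul rE rDisc rE; Add rA rA rE;
      Mul rE rU rV2; Mul rNeg rV rU2; Add rV rE rNeg; Add rU rA rZero;
      Mul rW rW rW2].

Definition mulx : prog := Seq
  (instrs [:: Add rU2 rHalfB rZero; Add rV2 rHalf rZero; Add rW2 rNorm rZero]) mul.

(** The table has 2 H entries: [rAcc] is below H before a digit is appended, hence below 2 H when it
    is used as an index. *)
Definition table : prog := Seq
  (instrs [:: Const rAcc 0; Const rU 1; Const rV 0; Const rW 1; Add rQ rH rH])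
  (While (TestLt rAcc rQ) (Seq
    (instrs [:: Write 1 rAcc rU; Write 2 rAcc rV; Write 3 rAcc rW;
                Add rAcc rAcc rOne])
    mulx)).

Definition flush : prog := Seq
  (instrs [:: Read rU2 1 rAcc; Read rV2 2 rAcc; Read rW2 3 rAcc; Const rAcc 0]) mul.

(* Between two iterations the current power times x^rAcc is x to the number formed
   by the digits read so far. *)
Definition window : prog := Seq
  (instrs [:: Const rAcc 0; Const rU 1; Const rV 0; Const rW 1])
  (Seq (While (TestLt rZero rL) (Seq sqr (Seq
         (instrs [:: Sub rL rL rOne; Read rA 0 rL; Add rAcc rAcc rAcc;
                     Add rAcc rAcc rA])
         (If (TestLt rAcc rH) Skip flush))))
    flush).

Definition set_flag : prog := instrs [:: Const rFlag 1].

Definition doubling : prog := Seq (instrs [:: Const rFlag 0])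
  (While (TestLt rZero rT) (Seq (instrs [:: Sub rT rT rOne]) (Seq
    (If (TestEq rType rZero)
      (If (TestEq rW rMinusOne) set_flag Skip)
      (If (TestEq rU rZero) set_flag Skip))
    sqr))).

(** * Computing powers of x: table, windowed exponentiation, repeated squaring *)

Section Powers.
Variables (n : nat) (w : nat -> nat) (b c : nat).
Hypotheses (n_odd : odd n) (n_gt1 : (1 < n)%N) (w_tape : random_tape n w).
Hypothesis c_coprime : coprime c n.

Let A : comNzRingType := qft_ring n b c.
Let x : A := qft_x n b c.
Let x_sqr : x ^+ 2 = b%:R * x + c%:R := qft_x_sqr n b c.
Let n0 : n%:R = 0 :> A := qft_natr0 b c n_gt1.
Let basis := qft_basis n_gt1 (b := b) (c := c).

Definition holds_power st j := represents b c x (reg st rU) (reg st rV) (reg st rW) j.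

Definition constants st : Prop :=
  [/\ reg st rZero = 0%N, reg st rOne = 1%N, reg st rMinusOne = n.-1,
      (reg st rDisc)%:R = (b ^ 2 + 4 * c)%N%:R :> A &
      represents b c x (reg st rHalfB) (reg st rHalf) (reg st rNorm) 1].

Definition constant_regs := [:: rZero; rOne; rMinusOne; rDisc; rHalfB; rHalf; rNorm].

(** For a concrete program the condition on the written registers holds by computation, so [isT]
    proves it. *)
Lemma constants_same p st st' : same_outside p st st' ->
  all (fun r => r \notin written p) constant_regs -> constants st -> constants st'.
Proof.
move=> [same _] /allP out; rewrite /constants.
have E r : r \in constant_regs -> reg st' r = reg st r by move=> /out; apply: same.
by rewrite !E.
Qed.

Lemma natr_residue z : (residue z n)%:R = z%:~R :> A.
Proof.
have -> : z%:~R = (z %% n%:Z)%Z%:~R :> A.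
  by rewrite {1}(divz_eq z n%:Z) rmorphD rmorphM /= -pmulrn n0 mulr0 add0r.
by rewrite /residue pmulrn gez0_abs // modz_ge0 // eqz_nat -lt0n ltnW.
Qed.

Lemma natr_residueB u v : (residue (u%:Z - v%:Z) n)%:R = u%:R - v%:R :> A.
Proof. by rewrite natr_residue rmorphB. Qed.

Lemma natr_pred : n.-1%:R = -1 :> A.
Proof. by apply/eqP; rewrite -subr_eq0 opprK natr1 prednK ?n0 // ltnW. Qed.

Let natrE := (natr_residueB, natr_mod n0, natrD, natrM).

Lemma wp_sqr st j (Q : state -> seq op -> Prop) : bounded n st -> holds_power st j ->
  (forall st' tr, bounded n st' -> same_outside sqr st st' -> holds_power st' (2 * j) ->
     cost_le tr 3 0 3 -> Q st' tr) -> wp n w sqr st Q.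
Proof.
move=> bd rep post.
suff : wp n w sqr st (fun st' tr => holds_power st' (2 * j) /\ cost_le tr 3 0 3).
  apply: wp_mono => st' tr e [h1 h2]; apply: post => //.
    exact: exec_bounded e bd.
  exact: exec_same_outside e.
apply: wp_instrs; split; last by split.
by apply: (represents_sqr x_sqr rep); rewrite /= /update /= !natrE.
Qed.

Lemma wp_mul st i j (Q : state -> seq op -> Prop) : bounded n st -> constants st ->
  holds_power st i ->
  represents b c x (reg st rU2) (reg st rV2) (reg st rW2) j ->
  (forall st' tr, bounded n st' -> same_outside mul st st' -> holds_power st' (i + j) ->
     cost_le tr 6 0 3 -> Q st' tr) -> wp n w mul st Q.
Proof.
move=> bd [z0 _ _ dE _] rep1 rep2 post.
suff : wp n w mul st (fun st' tr => holds_power st' (i + j) /\ cost_le tr 6 0 3).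
  apply: wp_mono => st' tr e [h1 h2]; apply: post => //.
    exact: exec_bounded e bd.
  exact: exec_same_outside e.
apply: wp_instrs; split; last by split.
by apply: (represents_mul x_sqr rep1 rep2);
  rewrite /= /update /= ?z0 ?addn0 !natrE ?dE ?natrE.
Qed.

Lemma wp_mulx st i (Q : state -> seq op -> Prop) : bounded n st -> constants st ->
  holds_power st i ->
  (forall st' tr, bounded n st' -> same_outside mulx st st' -> holds_power st' i.+1 ->
     cost_le tr 6 0 6 -> Q st' tr) -> wp n w mulx st Q.
Proof.
move=> bd cs rep1 post.
suff : wp n w mulx st (fun st' tr => holds_power st' i.+1 /\ cost_le tr 6 0 6).
  apply: wp_mono => st' tr e [h1 h2]; apply: post => //.
    exact: exec_bounded e bd.
  exact: exec_same_outside e.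
have [z0 _ _ _ rx] := cs.
apply: wp_seq; apply: wp_instrs.
apply: (@wp_mul _ i 1) => //.
- exact: run_instrs_bounded.
- rewrite /= /update /= z0 !addn0 !modn_small //; exact: bd.1.
- by move=> st' tr _ _; rewrite addn1 => h h2; split => //; costs.
Qed.

Definition table_ok st m := forall j, (j < m)%N ->
  represents b c x (arr st 1 j) (arr st 2 j) (arr st 3 j) j.

Lemma table_spec st : bounded n st -> constants st -> (2 * reg st rH < n)%N ->
  wp n w table st (fun st' tr =>
    table_ok st' (2 * reg st rH) /\
    cost_le tr (12 * reg st rH) 0 (22 * reg st rH + 6)).
Proof.
move=> bd cs hn; apply: wp_seq; apply: wp_instrs; set st1 := run_instrs _ _ _ st.
have cs1 : constants st1 by [].
have q1 : reg st1 rQ = (2 * reg st rH)%N.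
  by rewrite /st1 /= /update /= addnn modn_small -?mul2n.
apply: (@wp_loop n w n_gt1 w_tape _ _ st1 (fun st' tr =>
  [/\ (reg st' rAcc <= 2 * reg st rH)%N, holds_power st' (reg st' rAcc),
      table_ok st' (reg st' rAcc) &
      cost_le tr (6 * reg st' rAcc) 0 (11 * reg st' rAcc)]) _
  (fun st' => 2 * reg st rH - reg st' rAcc)%N).
- exact: run_instrs_bounded.
- rewrite /st1 /= /update /= mod0n; split=> //.
  by apply: represents0; rewrite /= ?mod0n ?(natr_mod n0).
- move=> st' tr bd' out [iH rep tb cE] /= test.
  have qE : reg st' rQ = (2 * reg st rH)%N by rewrite out.1.
  have cs' : constants st' by apply: constants_same out _ cs1.
  have [z' o' _ _ _] := cs'.
  rewrite qE in test.
  apply: wp_seq; apply: wp_instrs; set st2 := run_instrs _ _ _ st'.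
  have i2 : reg st2 rAcc = (reg st' rAcc).+1.
    by rewrite /st2 /= /update /= o' addn1 modn_small // (leq_ltn_trans _ hn).
  apply: (@wp_mulx _ (reg st' rAcc)) => //; first exact: run_instrs_bounded.
  move=> st3 tr3 bd3 out3 rep3 cE3.
  have i3 : reg st3 rAcc = (reg st' rAcc).+1 by rewrite out3.1.
  rewrite i3; split; last by lia.
  split=> //; last by costs.
  move=> j; rewrite !out3.2 // /st2 /= /update /= ltnS leq_eqVlt.
  by case: eqVneq => [-> //|_ /= /tb].
move=> st' tr bd' out [iH rep tb cE] /= test.
have qE : reg st' rQ = (2 * reg st rH)%N by rewrite out.1.
have iE : reg st' rAcc = (2 * reg st rH)%N by apply/eqP;
  rewrite eqn_leq iH leqNgt -qE test.
by rewrite iE in tb cE; split => //; costs.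
Qed.

Lemma wp_flush st i m (Q : state -> seq op -> Prop) : bounded n st -> constants st ->
  holds_power st i -> table_ok st m -> (reg st rAcc < m)%N ->
  (forall st' tr, bounded n st' -> same_outside flush st st' ->
     holds_power st' (i + reg st rAcc) -> reg st' rAcc = 0%N ->
     cost_le tr 6 0 7 -> Q st' tr) -> wp n w flush st Q.
Proof.
move=> bd cs rep1 tb acc post.
suff : wp n w flush st (fun st' tr =>
    [/\ holds_power st' (i + reg st rAcc), reg st' rAcc = 0%N & cost_le tr 6 0 7]).
  apply: wp_mono => st' tr e [h1 h2 h3]; apply: post => //.
    exact: exec_bounded e bd.
  exact: exec_same_outside e.
apply: wp_seq; apply: wp_instrs.
apply: (@wp_mul _ i (reg st rAcc)) => //.
- exact: run_instrs_bounded.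
- exact: tb.
- move=> st' tr _ out h h2; split; [done | | by costs].
  by rewrite out.1 //= /update /= mod0n.
Qed.

(* After j digits since the last flush, rAcc < 2^j; a flush needs rAcc >= H >= 2^g,
   so that there is at most one in g + 1 digits. *)
Lemma window_spec st g k : bounded n st -> constants st ->
  (2 * reg st rH < n)%N -> (2 ^ g <= reg st rH)%N ->
  table_ok st (2 * reg st rH) -> (k < 2 ^ reg st rL)%N ->
  (forall i, (i < reg st rL)%N -> arr st 0 i = odd (k %/ 2 ^ i)%N :> nat) ->
  wp n w window st (fun st' tr => holds_power st' k /\
    exists2 f, (f * g.+1 <= reg st rL)%N &
      cost_le tr (3 * reg st rL + 6 * f + 6) 0 (16 * reg st rL + 12)).
Proof.
move=> bd cs hn gH tb kL bit; have H_gt0 : (0 < reg st rH)%N.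
  by apply: leq_trans gH; rewrite expn_gt0.
apply: wp_seq; apply: wp_instrs; set st1 := run_instrs _ _ _ st.
apply: wp_seq.
(* In the invariant, [e] is the exponent of the power held in the registers, [f] the number of
   flushes so far and [j] the number of digits since the last one. *)
apply: (@wp_loop n w n_gt1 w_tape _ _ st1 (fun st' tr =>
  [/\ (reg st' rAcc < reg st rH)%N, (reg st' rL <= reg st rL)%N,
      exists2 e, holds_power st' e & (e + reg st' rAcc = k %/ 2 ^ reg st' rL)%N &
      exists f j, [/\ (reg st' rAcc < 2 ^ j)%N, (f * g.+1 + j <= reg st rL - reg st'
        rL)%N &
        cost_le tr (3 * (reg st rL - reg st' rL) + 6 * f) 0
                (16 * (reg st rL - reg st' rL))]]) _
  (fun st' => reg st' rL)).
- exact: run_instrs_bounded.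
- rewrite /st1 /= /update /= mod0n; split=> //.
    exists 0%N; last by rewrite divn_small.
    by apply: represents0; rewrite /= ?mod0n ?(natr_mod n0).
  by exists 0%N, 0%N; rewrite subnn.
- move=> st' tr bd' out [aH LL [e rep eE] [f [j [aj fj cE]]]] /= test.
  have cs' : constants st' by apply: constants_same out _ cs.
  have [z' o' _ _ _] := cs'; rewrite z' in test.
  have HE : reg st' rH = reg st rH by rewrite out.1.
  have arrE a i : arr st' a i = arr st a i by rewrite out.2.
  apply: wp_seq; apply: (@wp_sqr _ e) => // st2 tr2 bd2 out2 rep2 cE2.
  apply: wp_seq; apply: wp_instrs; set st3 := run_instrs _ _ _ st2.
  have L2 : reg st2 rL = reg st' rL by rewrite out2.1.
  have a2 : reg st2 rAcc = reg st' rAcc by rewrite out2.1.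
  have L3 : reg st3 rL = (reg st' rL).-1.
    by rewrite /st3 /= /update /= !out2.1 // o' residue_subn ?subn1 //; apply: bd'.1.
  set bt := odd (k %/ 2 ^ (reg st' rL).-1).
  have a3 : reg st3 rAcc = (2 * reg st' rAcc + bt)%N.
    have := L3; rewrite /st3 /= /update /= => ->; rewrite a2 out2.2 // arrE bit;
      last first.
      by apply: leq_trans LL; rewrite prednK.
    rewrite -/bt addnn -mul2n (@modn_small (2 * _)) ?modn_small //.
      by apply: leq_ltn_trans hn; lia.
    by apply: leq_ltn_trans hn; lia.
  (* Squaring doubles [e], and the new digit enters through [rAcc]: together one more leading digit
     of k. *)
  have eE3 : (2 * e + reg st3 rAcc = k %/ 2 ^ reg st3 rL)%N.
    rewrite a3 L3 addnA -mulnDr eE -{1}(prednK test) expnSr divnMA divn2.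
    by rewrite /bt; lia.
  have aj3 : (reg st3 rAcc < 2 ^ j.+1)%N.
    by move: aj; rewrite a3 expnS; clear; case: bt; lia.
  have acc3 : (reg st3 rAcc < 2 * reg st rH)%N by move: aH; rewrite a3; clear;
    case: bt; lia.
  have bd3 : bounded n st3 by exact: run_instrs_bounded.
  have rep3 : holds_power st3 (2 * e) by [].
  have H3 : reg st3 rH = reg st rH by rewrite -HE -(out2.1 rH).
  have arr3 a : arr st3 a = arr st a by rewrite -[LHS]/(arr st2 a) out2.2 // out.2.
  have cs3 : constants st3.
    have := constants_same out2 isT cs'; exact: id.
  clearbody st3.
  apply: wp_if; rewrite {1}/run_test => t3.
    rewrite H3 in t3.
    apply: wp_skip; rewrite L3; split; last by rewrite prednK.
    split=> //; first by rewrite (leq_trans (leq_pred _)).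
    + by exists (2 * e)%N; rewrite // -L3.
    exists f, j.+1; split=> //; first by move: fj test LL; clear; lia.
        by move: cE cE2 test LL; clear; costs.
  rewrite H3 in t3.
  apply: (@wp_flush _ (2 * e)%N (2 * reg st rH)) => //.
  + by move=> i /tb; rewrite !arr3.
  move=> st4 tr4 bd4 out4 rep4 acc4 cE4.
  have L4 : reg st4 rL = (reg st' rL).-1 by rewrite out4.1.
  rewrite L4 acc4; split; last by rewrite prednK.
  split=> //; first by rewrite (leq_trans (leq_pred _)).
    by exists (2 * e + reg st3 rAcc)%N; rewrite // addn0 eE3 L3.
  have gj : (g < j.+1)%N.
    rewrite -(@ltn_exp2l 2) //; apply: leq_ltn_trans gH _.
    by apply: leq_ltn_trans aj3; rewrite leqNgt t3.
  exists f.+1, 0%N; split=> //.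
    by rewrite mulSn; move: fj gj test LL; clear; lia.
  by move: cE cE2 cE4 test LL; clear; costs.
move=> st' tr bd' out [aH LL [e rep eE] [f [j [aj fj cE]]]] /= test.
have cs' : constants st' by apply: constants_same out _ cs.
have [z' o' _ _ _] := cs'.
have L0 : reg st' rL = 0%N by move: test; rewrite z'; case: (reg st' rL).
have arrE a i : arr st' a i = arr st a i by rewrite out.2.
apply: (@wp_flush _ e (2 * reg st rH)) => //.
- by move=> i /tb; rewrite !arrE.
- by lia.
move=> st4 tr4 bd4 out4 rep4 acc4 cE4; split.
  by move: rep4; rewrite eE L0 expn0 divn1.
exists f; first by lia.
by rewrite L0 in cE; costs.
Qed.

(** For M = 2^i (2 k + 1) this is the form that x^(2^(i + 1) s) = -1 takes in [qft_final1] and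
    [qft_final3] respectively. *)
Definition flag_test ty M : bool :=
  if ty == 0%N then (- c%:R : A) ^+ M == -1 else x ^+ (2 * M) == - (- c%:R) ^+ M.

Lemma doubling_spec st M : bounded n st -> constants st -> holds_power st M ->
  wp n w doubling st (fun st' tr =>
    [/\ holds_power st' (2 ^ reg st rT * M),
        reg st' rFlag = [exists i : 'I_(reg st rT), flag_test (reg st rType) (2 ^ i *
          M)]
          :> nat &
        cost_le tr (3 * reg st rT) 0 (8 * reg st rT + 2)]).
Proof.
move=> bd cs rep0; set t0 := reg st rT.
apply: wp_seq; apply: wp_instrs; set st1 := run_instrs _ _ _ st.
apply: (@wp_loop n w n_gt1 w_tape _ _ st1 (fun st' tr =>
  let i := (t0 - reg st' rT)%N in
  [/\ (reg st' rT <= t0)%N, holds_power st' (2 ^ i * M),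
      reg st' rFlag = has (fun j => flag_test (reg st rType) (2 ^ j * M)) (iota 0 i)
        :> nat &
      cost_le tr (3 * i) 0 (8 * i)]) _
  (fun st' => reg st' rT)).
- exact: run_instrs_bounded.
- by rewrite /st1 /= /update /= -/t0 subnn mod0n mul1n; split.
- move=> st' tr bd' out /= [tt rep fl cE] test.
  have cs' : constants st' by apply: constants_same out _ cs.
  have [z' o' m1 _ rx] := cs'; rewrite z' in test.
  apply: wp_seq; apply: wp_instrs; set st2 := run_instrs _ _ _ st'.
  have T2 : reg st2 rT = (reg st' rT).-1.
    by rewrite /st2 /= /update /= o' residue_subn ?subn1 //; apply: bd'.1.
  have bd2 : bounded n st2 by exact: run_instrs_bounded.
  set i := (t0 - reg st' rT)%N in rep fl cE *.
  have iE : (t0 - (reg st' rT).-1)%N = i.+1 by rewrite /i; lia.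
  have ty2 : reg st2 rType = reg st rType by rewrite -[RHS](out.1 rType).
  apply: wp_seq.
  set fb := has _ _ in fl.
  have : wp n w (If (TestEq rType rZero)
      (If (TestEq rW rMinusOne) set_flag Skip)
      (If (TestEq rU rZero) set_flag Skip)) st2 (fun st3 tr3 =>
      reg st3 rFlag = fb || flag_test (reg st rType) (2 ^ i * M) :> nat /\
      cost_le tr3 0 0 3).
    (* [rW] holds the norm of the current power, which is a power of -c. *)
    have flW : (reg st2 rW == reg st2 rMinusOne) = ((- c%:R : A) ^+ (2 ^ i * M) == -1).
      have [_ <- _] := rep; rewrite -natr_pred [reg st2 rMinusOne]m1.
      apply/eqP/eqP => [e|]; first exact: (congr1 (fun k : nat => k%:R : A) e).
      apply: (natr_inj n_odd basis); first exact: bd'.1.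
      by rewrite prednK // ltnW.
    have flU : (reg st2 rU == reg st2 rZero) =
               (x ^+ (2 * (2 ^ i * M)) == - (- c%:R) ^+ (2 ^ i * M)).
      rewrite [reg st2 rZero]z'.
      exact: (represents_trace0 n_odd n_gt1 c_coprime (bd'.1 rU) rep).
    have fl2 : reg st2 rFlag = fb by [].
    have z2 : reg st2 rZero = 0%N by [].
    rewrite /flag_test; clearbody st2.
    apply: wp_if; rewrite {1}/run_test ty2 z2 => ->.
      apply: wp_if; rewrite {1}/run_test flW => ->.
        apply: wp_instrs; split; last by [].
        by rewrite /= /update /= modn_small // orbT.
      by apply: wp_skip; rewrite orbF.
    apply: wp_if; rewrite {1}/run_test flU => ->.
      apply: wp_instrs; split; last by [].
      by rewrite /= /update /= modn_small // orbT.
    by apply: wp_skip; rewrite orbF.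
  apply: wp_mono => st3 tr3 e3 [fl3 cE3].
  have bd3 := exec_bounded n_gt1 w_tape e3 bd2.
  have out3 := exec_same_outside e3.
  apply: (@wp_sqr _ (2 ^ i * M)) => //.
    by rewrite /holds_power !out3.1.
  move=> st4 tr4 bd4 out4 rep4 cE4.
  have T4 : reg st4 rT = (reg st' rT).-1 by rewrite out4.1 // out3.1.
  rewrite T4 iE; split; last by lia.
  split; [by lia | by rewrite expnS -mulnA | | by costs].
  rewrite out4.1 // fl3 -[i.+1]addn1 iotaD has_cat /= orbF add0n.
  by [].
move=> st' tr bd' out /= [tt rep fl cE] test.
have z' : reg st' rZero = 0%N by rewrite out.1 //; case: cs.
have T0 : reg st' rT = 0%N by move: test; rewrite z'; case: (reg st' rT).
rewrite T0 subn0 in rep fl cE; split=> //; last by costs.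
rewrite fl; congr nat_of_bool; apply/hasP/existsP => [[j]|[j fj]].
  by rewrite mem_iota => /= jt fj; exists (Ordinal jt).
by exists (j : nat); rewrite // mem_iota /=.
Qed.

End Powers.

(* The machine only sees constants modulo n: k < n iff reduction modulo n keeps
   0, ..., k increasing. *)
Fixpoint less_modulus (k : nat) : prog :=
  if k is k'.+1 then
    Seq (less_modulus k') (Seq (instrs [:: Const rA k'; Const rE k])
      (If (TestLt rA rE) Skip (instrs [:: Const rNeg 0])))
  else instrs [:: Const rNeg 1].

(** The condition p <= sqrt n is tested as p^2 - 1 < n. A zero in [rE] is the default value of
    [inv_mod] and means that p divides n. *)
Fixpoint trial_division (ps : seq nat) : prog :=
  if ps is p :: ps' then
    Seq (less_modulus (p ^ 2).-1) (Seq (instrs [:: Const rA p; Inv rE rA])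
      (Seq (If (TestEq rNeg rOne)
              (If (TestEq rE rZero) (instrs [:: Const rSmall 1]) Skip) Skip)
        (trial_division ps')))
  else Skip.

(** A crude bound; for the primes up to B it depends on B alone. *)
Definition trial_cost (ps : seq nat) : nat := (\sum_(p <- ps) (4 * p ^ 2 + 10))%N.

Definition good : prog := instrs [:: Const rVerdict 1].

(** [rE] receives a (-c)^k, which is compared up to sign with the element stored in [rUs] and [rVs];
    a scalar can match only if [rVs] is 0. *)
Definition decide : prog := Seq
  (instrs [:: Mul rA rU rU; Mul rE rU rNk; Sub rNeg rZero rUs; Const rVerdict 0])
  (If (TestEq rSmall rZero) (If (TestEq rV rZero) (If (TestEq rA rNorm)
    (If (TestEq rFlag rOne) good
      (If (TestEq rVs rZero)
        (If (TestEq rE rUs) good (If (TestEq rE rNeg) good Skip)) Skip))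
    Skip) Skip) Skip).

(** As n > 1, a genuine inverse is never 0, so the default value is unambiguous. *)
Lemma inv_mod_eq0 n v : (1 < n)%N -> (inv_mod n v == 0%N) = ~~ coprime v n.
Proof.
move=> n_gt1; rewrite /inv_mod; case: pickP => [u /eqP vu|no].
  have -> : coprime v n.
    have : coprime (v * u) n by rewrite -coprime_modl vu coprime_modl coprime1n.
    by rewrite coprimeMl => /andP[].
  by case: eqP => // u0; move: vu; rewrite u0 muln0 mod0n modn_small.
rewrite eqxx; apply/esym/negP => co.
have [u un vu] := coprime_inverse n_gt1 co.
by have := no (Ordinal un); rewrite /= vu.
Qed.

(** * Trial division and the final decision *)

Section Trial.
Variables (n : nat) (w : nat -> nat).
Hypotheses (n_gt1 : (1 < n)%N) (w_tape : random_tape n w).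

Lemma less_modulus_spec k st :
  wp n w (less_modulus k) st (fun st' tr =>
    reg st' rNeg = (k < n)%N :> nat /\ cost_le tr 0 0 (4 * k + 1)).
Proof.
elim: k st => [|k IH] st /=.
  by apply: wp_instrs; rewrite /= /update /= (modn_small n_gt1) ltnW.
apply: wp_seq; apply: wp_mono (IH st) => st1 tr1 _ [r1 c1].
apply: wp_seq; apply: wp_instrs; apply: wp_if; rewrite /= /update /= => t.
  apply: wp_skip; rewrite /= /update /= r1; split; last by costs.
  (* The critical value is k + 1 = n, where the constant k + 1 is loaded as 0 and the comparison
     fails; beyond it the flag is 0 already. *)
  by case: (ltngtP k.+1 n) => // kn; move: t; rewrite kn modnn.
apply: wp_instrs; rewrite /= /update /= mod0n; split; last by costs.
by case: (ltnP k.+1 n) => // kn; rewrite !modn_small ?ltnSn // ltnW in t.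
Qed.

Lemma trial_division_spec ps (fb : bool) st : bounded n st ->
  reg st rZero = 0%N -> reg st rOne = 1%N -> reg st rSmall = fb -> all prime ps ->
  wp n w (trial_division ps) st (fun st' tr =>
    reg st' rSmall = fb || has (fun p => (p %| n)%N && (p ^ 2 <= n)%N) ps :> nat /\
    cost_le tr 0 (size ps) (trial_cost ps)).
Proof.
elim: ps fb st => [|p ps IH] fb st bd z0 o1 sE /=.
  by move=> _; apply: wp_skip; rewrite orbF.
move=> /andP[pp pps]; have p_gt0 := prime_gt0 pp.
have frame k : all (fun r => r \notin written (less_modulus k)) [:: rZero; rOne;
  rSmall].
  by elim: k => //= k; rewrite /written /= !pmap_cat /= !mem_cat !inE !negb_or /=
    ?andbT.
apply: wp_seq; apply: wp_mono (less_modulus_spec (p ^ 2).-1 st) => st1 tr1 e1 [r1 c1].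
have bd1 := exec_bounded n_gt1 w_tape e1 bd.
have out1 := exec_same_outside e1.
have /and4P[f1 f2 f3 _] := frame (p ^ 2).-1.
have {out1} [z1 o1' s1] : [/\ reg st1 rZero = 0%N, reg st1 rOne = 1%N & reg st1
  rSmall = fb].
  by rewrite !out1.1.
apply: wp_seq; apply: wp_instrs; set st2 := run_instrs _ _ _ _.
have bd2 : bounded n st2 by exact: run_instrs_bounded.
have E2 : (reg st2 rE == 0%N) = (p %| n)%N.
  by rewrite /st2 /= /update /= inv_mod_eq0 // coprime_modl prime_coprime // negbK.
have N2 : reg st2 rNeg = (p ^ 2 <= n)%N :> nat by rewrite -(prednK (n := p ^ 2))
  ?expn_gt0 ?p_gt0.
have [z2 o2 s2] : [/\ reg st2 rZero = 0%N, reg st2 rOne = 1%N & reg st2 rSmall = fb]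
  by [].
clearbody st2; apply: wp_seq.
have : wp n w (If (TestEq rNeg rOne)
              (If (TestEq rE rZero) (instrs [:: Const rSmall 1]) Skip) Skip) st2
   (fun st3 tr3 => reg st3 rSmall = fb || ((p %| n)%N && (p ^ 2 <= n)%N) :> nat /\
      cost_le tr3 0 0 3).
  apply: wp_if; rewrite {1}/run_test N2 o2 eqb1 => ->; last first.
    by apply: wp_skip; rewrite andbF orbF.
  rewrite andbT; apply: wp_if; rewrite {1}/run_test z2 E2 => ->.
    by apply: wp_instrs; rewrite /= /update /= (modn_small n_gt1) orbT.
  by apply: wp_skip; rewrite orbF.
apply: wp_mono => st3 tr3 e3 [s3 c3].
have bd3 := exec_bounded n_gt1 w_tape e3 bd2.
have out3 := exec_same_outside e3.
apply: wp_mono (IH _ st3 bd3 _ _ s3 pps); rewrite ?out3.1 //.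
move=> st4 tr4 _ [s4 c4]; rewrite orbA s4; split=> //.
rewrite /trial_cost big_cons -/(trial_cost ps).
by move: c1 c3 c4; move: (trial_cost ps); clear; costs.
Qed.

Lemma decide_spec st : bounded n st -> reg st rZero = 0%N -> reg st rOne = 1%N ->
  wp n w decide st (fun st' tr =>
    let e := ((reg st rU * reg st rNk) %% n)%N in
    reg st' rVerdict = [&& reg st rSmall == 0%N, reg st rV == 0%N,
      ((reg st rU * reg st rU) %% n)%N == reg st rNorm &
      (reg st rFlag == 1%N) || ((reg st rVs == 0%N) &&
        ((e == reg st rUs) || (e == residue (0 - (reg st rUs)%:Z) n)))] :> nat /\
    cost_le tr 2 0 10).
Proof.
move=> bd z0 o1; apply: wp_seq; apply: wp_instrs.
set st1 := run_instrs _ _ _ _ => /=.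
have v1 : reg st1 rVerdict = 0%N by rewrite /st1 /= /update /= mod0n.
have a1 : reg st1 rA = ((reg st rU * reg st rU) %% n)%N by [].
have e1 : reg st1 rE = ((reg st rU * reg st rNk) %% n)%N by [].
have g1 : reg st1 rNeg = residue (0 - (reg st rUs)%:Z) n.
  by rewrite /st1 /= /update /= z0.
have same1 : [/\ reg st1 rZero = 0%N, reg st1 rOne = 1%N, reg st1 rSmall = reg st
  rSmall,
  reg st1 rV = reg st rV & reg st1 rNorm = reg st rNorm] by [].
have same2 : [/\ reg st1 rFlag = reg st rFlag, reg st1 rVs = reg st rVs &
  reg st1 rUs = reg st rUs] by [].
clearbody st1; case: same1 => z1 o1' s1 vv n1; case: same2 => f1 vs1 us1.
have yes (Q : state -> seq op -> Prop) : (forall st', reg st' rVerdict = 1%N -> Q st'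
  [:: OpAdd]) ->
    wp n w good st1 Q.
  by move=> h; apply: wp_instrs; apply: h; rewrite /= /update /= modn_small.
have no (Q : state -> seq op -> Prop) : Q st1 [::] -> wp n w Skip st1 Q by apply:
  wp_skip.
apply: wp_if; rewrite {1}/run_test s1 z1 => -> /=; last by apply: no; rewrite v1.
apply: wp_if; rewrite {1}/run_test vv z1 => -> /=; last by apply: no; rewrite v1.
apply: wp_if; rewrite {1}/run_test a1 n1 => -> /=; last by apply: no; rewrite v1.
apply: wp_if; rewrite {1}/run_test f1 o1' => -> /=; first by apply: yes => st' ->.
apply: wp_if; rewrite {1}/run_test vs1 z1 => -> /=; last by apply: no; rewrite v1.
apply: wp_if; rewrite {1}/run_test e1 us1 => -> /=; first by apply: yes => st' ->.
apply: wp_if; rewrite {1}/run_test e1 g1 => -> /=; first by apply: yes => st' ->.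
by apply: no; rewrite v1.
Qed.

End Trial.

(** Halving n - 1 as a natural number gives (n - 1) / 2; if this is odd, adding 1 yields m = (n + 1)
    / 2. *)
Definition prepare : prog := Seq
  (instrs [:: Add rA rOne rOne; Inv rHalf rA; Mul rHalfB rHalf rB;
              Half rM rMinusOne; Half rE rM; Add rE rE rE; Const rT 0;
              Const rSmall 0])
  (If (TestEq rE rM) (instrs [:: Const rType 0])
    (instrs [:: Const rType 1; Add rM rM rOne])).

Definition power : prog := Seq bits (Seq bit_length (Seq table window)).

(** The value (-c)^k needs no extra computation: it is the norm carried along with x^k. *)
Definition climb : prog := Seq (instrs [:: Add rNk rW rZero])
  (Seq sqr (Seq mulx
    (Seq (instrs [:: Add rUs rU rZero; Add rVs rV rZero]) doubling))).

(** For n = 1 mod 4 the squarings end at (n - 1) / 2, so one factor x is missing; moreover a (-c)^k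
    is then x^s itself and is to be compared with 1 instead of x^(2 k + 1). *)
Definition half_order : prog :=
  If (TestEq rType rZero) (Seq mulx (instrs [:: Const rUs 1; Const rVs 0])) Skip.

Definition small_primes (B : nat) : seq nat := [seq p <- iota 0 B.+1 | prime p].

Definition qft_prog (B : nat) : prog :=
  Seq prepare (Seq split_even (Seq power (Seq climb (Seq half_order
    (Seq (trial_division (small_primes B)) decide))))).

Lemma inv_modP n v : (1 < n)%N -> coprime v n -> (v * inv_mod n v = 1 %[mod n])%N.
Proof.
move=> n_gt1 co; rewrite /inv_mod; case: pickP => [u /eqP //|no].
by have [u un vu] := coprime_inverse n_gt1 co; have := no (Ordinal un); rewrite /= vu.
Qed.

Lemma small_factorE B n :
  small_factor B n = has (fun p => (p %| n)%N && (p ^ 2 <= n)%N) (small_primes B).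
Proof.
apply/existsP/hasP => [[p /and3P[pp pn p2]]|[p]].
  by exists (p : nat); [rewrite mem_filter pp mem_iota /= add0n | rewrite pn p2].
rewrite mem_filter mem_iota /= add0n => /andP[pp pB] /andP[pn p2].
by exists (Ordinal pB); rewrite /= pp pn.
Qed.

(** The program is generated from a list, so its frame is established by induction. *)
Lemma written_trial_division ps r :
  r \notin [:: rNeg; rA; rE; rSmall] -> r \notin written (trial_division ps).
Proof.
move=> rn; have less k : r \notin written (less_modulus k).
  elim: k => [|k IH]; move: rn; rewrite !inE !negb_or => /and4P[h1 h2 h3 h4].
    by rewrite /written /= /instrs /=.
  by move: IH; rewrite /written /= /instrs /= !pmap_cat !mem_cat !negb_or => -> /=;
    rewrite ?inE ?negb_or ?h1 ?h2 ?h3.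
elim: ps => // p ps IH; move: rn IH (less (p ^ 2).-1).
rewrite /written /= /instrs /= !pmap_cat !mem_cat /= !inE ?negb_or => /and4P[h1 h2 h3
  h4] -> ->.
by rewrite ?h1 ?h2 ?h3 ?h4.
Qed.

(** * Correctness and cost of the Quadratic Frobenius Test *)

Section Qft.
Variables (n : nat) (w : nat -> nat) (b c : nat).
Hypotheses (n_odd : odd n) (n_gt1 : (1 < n)%N) (w_tape : random_tape n w).
Hypothesis c_coprime : coprime c n.

Let A : comNzRingType := qft_ring n b c.
Let x : A := qft_x n b c.
Let n0 : n%:R = 0 :> A := qft_natr0 b c n_gt1.
Let basis := qft_basis n_gt1 (b := b) (c := c).

Definition qft_inputs st : Prop :=
  [/\ reg st rZero = 0%N, reg st rOne = 1%N, reg st rMinusOne = n.-1 &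
  [/\ reg st rB = b, (reg st rDisc)%:R = (b ^ 2 + 4 * c)%N%:R :> A &
      (reg st rNorm)%:R = - c%:R :> A]].

Lemma prepare_spec st : bounded n st -> qft_inputs st ->
  wp n w prepare st (fun st' tr =>
    [/\ constants n b c st', reg st' rT = 0%N, reg st' rSmall = 0%N,
        [/\ ~~ odd (reg st' rM), (0 < reg st' rM)%N &
        if reg st' rType == 0%N then n = (2 * reg st' rM).+1
        else n.+1 = (2 * reg st' rM)%N] & cost_le tr 1 1 9]).
Proof.
move=> bd [z0 o1 m1 [bE dE cE]]; apply: wp_seq; apply: wp_instrs.
have n_gt2 : (2 < n)%N by move: n_odd n_gt1; clear; lia.
set st1 := run_instrs _ _ _ _.
have c1 : constants n b c st1.
  split=> //; have a2 : ((reg st rOne + reg st rOne) %% n)%N = 2%N by rewrite o1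
    modn_small.
  apply: (@represents1 _ b c x (inv_mod n 2)); rewrite /st1 /= /update /= ?a2 ?bE //.
  - have := inv_modP n_gt1 (v := 2); rewrite coprime2n => /(_ n_odd) e.
    by rewrite -natrM -(natr_mod n0) e (natr_mod n0).
  - by rewrite (natr_mod n0) natrM.
have t1 : reg st1 rT = 0%N by rewrite /st1 /= /update /= mod0n.
have s1 : reg st1 rSmall = 0%N by rewrite /st1 /= /update /= mod0n.
have M1 : reg st1 rM = n.-1./2 by rewrite /st1 /= /update /= m1.
have E1 : reg st1 rE = n.-1./2./2.*2.
  rewrite /st1 /= /update /= m1 addnn modn_small //.
  by move: n_gt2; clear; lia.
have [z1 o1'] : reg st1 rZero = 0%N /\ reg st1 rOne = 1%N by [].
clearbody st1; apply: wp_if; rewrite {1}/run_test E1 M1 => test; apply: wp_instrs.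
  have c2 : constants n b c (run_instrs n w [:: Const rType 0] st1) by [].
  split=> //; rewrite /= /update /= mod0n /= M1.
  by move: test n_gt2 n_odd; clear=> /eqP; split; lia.
have c2 : constants n b c (run_instrs n w [:: Const rType 1; Add rM rM rOne] st1) by [].
split=> //; rewrite /= /update /= (modn_small n_gt1) /= M1 o1'.
rewrite modn_small; last by move: n_gt2; clear; lia.
by move: test n_gt2 n_odd; clear=> /eqP; split; lia.
Qed.

(** [q] will be the integer part of log2 m, [H.-1] the bit length of [q.-1], and [f] the number of
    flushes in the digit loop, spaced by at least [(trunc_log 2 H).+1] digits. *)
Definition powering_cost (q f H : nat) : Prop :=
  [/\ (q.-1 < 2 ^ H.-1)%N, (0 < q.-1)%N -> (2 ^ H.-2 <= q.-1)%N, (0 < H <= q)%N &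
      (f * (trunc_log 2 H).+1 <= q)%N].

(** Only q - t digits are processed here; the other t squarings happen in [climb], so that 3 q is
    the leading term of the total. *)
Lemma power_spec st k t : bounded n st -> constants n b c st ->
  reg st rE = k -> reg st rT = t -> (0 < t)%N ->
  (2 * (2 ^ t * (2 * k).+1) <= n.+1)%N ->
  wp n w power st (fun st' tr => holds_power n b c st' k /\
    exists q f H, [/\ (2 ^ q <= 2 ^ t * (2 * k).+1 < 2 ^ q.+1)%N, (t <= q)%N,
      powering_cost q f H &
      cost_le tr (3 * (q - t) + 6 * f + 12 * H + 6) 0 (23 * (q - t) + 25 * H + 25)]).
Proof.
move=> bd cs kE tE t_gt0 mn; have [z0 o1 _ _ _] := cs.
apply: wp_seq; apply: wp_mono (bits_spec n_odd n_gt1 w_tape bd z0 o1) => st1 tr1 e1.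
rewrite kE => -[kL Lk k0 bit c1].
have bd1 := exec_bounded n_gt1 w_tape e1 bd; have out1 := exec_same_outside e1.
have cs1 := constants_same out1 isT cs; have [z1 o1' _ _ _] := cs1.
set L := reg st1 rL in kL Lk k0 bit c1.
have t1 : reg st1 rT = t by rewrite out1.1.
have q_bounds : (2 ^ (L + t) <= 2 ^ t * (2 * k).+1 < 2 ^ (L + t).+1)%N.
  have Lbounds : (2 ^ L <= (2 * k).+1 < 2 * 2 ^ L)%N.
    have [k00|k_gt0] := posnP k; first by rewrite k00 (k0 k00).
    have := Lk k_gt0; move: kL; case: (L) => [|L'] /=; first by move: k_gt0; clear; lia.
    by rewrite expnS; clear; lia.
  by rewrite expnS addnC expnD mulnCA leq_pmul2l ?ltn_pmul2l ?expn_gt0.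
(* From L + t < 2^(L + t) <= m and 2 m <= n + 1; the counters and the table size therefore do not
   wrap around modulo n. *)
have qn : (2 * (L + t) < n)%N.
  have h : ((L + t) < 2 ^ (L + t))%N by apply: ltn_expl.
  by move: q_bounds mn h => /andP[h1 _]; clear -t_gt0 h1; lia.
have lt_n : (0 < reg st1 rL + reg st1 rT < n)%N.
  by rewrite t1 -/L; move: t_gt0 qn; clear; lia.
apply: wp_seq; apply: wp_mono (bit_length_spec n_odd n_gt1 w_tape bd1 z1 o1' lt_n) =>
  st2 tr2 e2.
rewrite t1 -/L subn1 => -[qH Hq H_gt0 c2].
have bd2 := exec_bounded n_gt1 w_tape e2 bd1; have out2 := exec_same_outside e2.
have cs2 := constants_same out2 isT cs1.
set H := reg st2 rH in qH Hq H_gt0 c2.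
have Hq' : (0 < H <= L + t)%N by move: H_gt0 t_gt0; clear; lia.
have Hn : (2 * H < n)%N by move: Hq' qn; clear; lia.
apply: wp_seq; apply: wp_mono (table_spec n_odd n_gt1 w_tape c_coprime bd2 cs2 Hn) =>
  st3 tr3 e3 [tb c3].
have bd3 := exec_bounded n_gt1 w_tape e3 bd2; have out3 := exec_same_outside e3.
have cs3 := constants_same out3 isT cs2.
have H3 : reg st3 rH = H by rewrite out3.1.
have L3 : reg st3 rL = L by rewrite out3.1 // out2.1.
have gH : (2 ^ trunc_log 2 H <= H)%N by apply: trunc_logP; case/andP: Hq'.
rewrite -/H in tb c3; rewrite -H3 in Hn tb gH; rewrite -L3 in kL.
have bit3 i : (i < reg st3 rL)%N -> arr st3 0 i = odd (k %/ 2 ^ i)%N :> nat.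
  by rewrite L3 => /bit <-; rewrite out3.2 // out2.2.
apply: wp_mono (window_spec n_odd n_gt1 w_tape c_coprime bd3 cs3 Hn gH tb kL bit3).
rewrite L3 H3 => st4 tr4 e4 [rep [f ff c4]]; split=> //.
exists (L + t)%N, f, H; split=> //; first exact: leq_addl.
  by split=> //; apply: leq_trans ff _; apply: leq_addr.
by rewrite addnK; move: c1 c2 c3 c4; clear; costs.
Qed.

Lemma climb_spec st k t : bounded n st -> constants n b c st ->
  holds_power n b c st k -> reg st rT = t ->
  wp n w climb st (fun st' tr =>
    [/\ holds_power n b c st' (2 ^ t * (2 * k).+1),
        (reg st' rNk)%:R = (- c%:R) ^+ k :> A,
        (reg st' rUs)%:R + (reg st' rVs)%:R * sqrt_disc b x = x ^+ (2 * k).+1,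
        reg st' rFlag =
          [exists i : 'I_t, flag_test n b c (reg st rType) (2 ^ i * (2 * k).+1)] :>
            nat &
        cost_le tr (3 * t + 9) 0 (8 * t + 14)]).
Proof.
move=> bd cs rep tE; have [z0 _ _ _ _] := cs.
have Wn := bd.1 rW.
apply: wp_seq; apply: wp_instrs; set st1 := run_instrs _ _ _ _.
have bd1 : bounded n st1 by exact: run_instrs_bounded.
have cs1 : constants n b c st1 by [].
have N1 : reg st1 rNk = reg st rW by rewrite /st1 /= /update /= z0 addn0 modn_small.
have rep1 : holds_power n b c st1 k by [].
have [t1 ty1] : reg st1 rT = t /\ reg st1 rType = reg st rType by [].
clearbody st1.
apply: wp_seq; apply: (wp_sqr n_gt1 w_tape (b := b) (c := c) (j := k)) => // st2 tr2
  bd2 out2 rep2 c2.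
have cs2 := constants_same out2 isT cs1.
apply: wp_seq; apply: (@wp_mulx _ _ b c n_gt1 w_tape _ (2 * k)) => // st3 tr3 bd3
  out3 rep3 c3.
have cs3 := constants_same out3 isT cs2; have [z3 _ _ _ _] := cs3.
have Un := bd3.1 rU; have Vn := bd3.1 rV.
have N3 : reg st3 rNk = reg st rW by rewrite out3.1 // out2.1.
have [t3 ty3] : reg st3 rT = t /\ reg st3 rType = reg st rType.
  by rewrite !out3.1 // !out2.1.
apply: wp_seq; apply: wp_instrs; set st4 := run_instrs _ _ _ _.
have bd4 : bounded n st4 by exact: run_instrs_bounded.
have cs4 : constants n b c st4 by [].
have rep4 : holds_power n b c st4 (2 * k).+1 by [].
have [us4 vs4] : reg st4 rUs = reg st3 rU /\ reg st4 rVs = reg st3 rV.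
  by rewrite /st4 /= /update /= z3 !addn0 !modn_small.
have N4 : reg st4 rNk = reg st rW by [].
have [t4 ty4] : reg st4 rT = t /\ reg st4 rType = reg st rType by [].
clearbody st4.
apply: wp_mono (doubling_spec n_odd n_gt1 w_tape c_coprime bd4 cs4 rep4) => st5 tr5 e5.
rewrite t4 ty4 => -[rep5 fl5 c5]; have out5 := exec_same_outside e5.
split=> //.
- by rewrite out5.1 // N4; case: rep.
- by rewrite !out5.1 // us4 vs4; case: rep3.
- by move: c2 c3 c5; clear; costs.
Qed.

Lemma half_order_spec st m s : bounded n st -> constants n b c st ->
  holds_power n b c st m ->
  (reg st rUs)%:R + (reg st rVs)%:R * sqrt_disc b x = x ^+ s ->
  wp n w half_order st (fun st' tr =>
    [/\ holds_power n b c st' (if reg st rType == 0%N then m.+1 else m),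
        (reg st' rUs)%:R + (reg st' rVs)%:R * sqrt_disc b x =
          if reg st rType == 0%N then 1 else x ^+ s &
        cost_le tr 6 0 9]).
Proof.
move=> bd cs rep us; have [z0 _ _ _ _] := cs.
apply: wp_if; rewrite {1}/run_test z0 => -> /=; last by apply: wp_skip.
apply: wp_seq; apply: (@wp_mulx _ _ b c n_gt1 w_tape _ m) => // st1 tr1 bd1 out1 rep1
  c1.
apply: wp_instrs; split=> //; last by move: c1; clear; costs.
by rewrite /= /update /= mod0n (modn_small n_gt1) mul0r addr0.
Qed.

(** By [coord_eq] a scalar equals u + v d up to sign only if v = 0; what remains is a comparison of
    residues. *)
Lemma half_power_eq (e u v : nat) (y : A) : (e < n)%N -> (u < n)%N -> (v < n)%N ->
  u%:R + v%:R * sqrt_disc b x = y ->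
  (e%:R == y) || (e%:R == - y) =
  (v == 0%N) && ((e == u) || (e == residue (0 - u%:Z) n)).
Proof.
move=> en un vn yE.
have resE : (residue (0 - u%:Z) n)%:R = - u%:R :> A.
  by rewrite (natr_residueB b c n_gt1 0%N) sub0r.
have case_ (z : A) (e' : nat) : (e' < n)%N -> z = e'%:R -> v = 0%N -> (e%:R == z) =
  (e == e').
  move=> e'n -> _; apply/eqP/eqP => [|-> //]; exact: (natr_inj n_odd basis).
have v0P : (e%:R == y) || (e%:R == - y) -> v = 0%N.
  case/orP => /eqP E.
    by apply: (coord_eq n_odd n0 basis vn (b := b) (u := u) (w := e)); rewrite yE E.
  apply: (coord_eq n_odd n0 basis vn (b := b) (u := u) (w := residue (0 - e%:Z) n)).
  by rewrite yE (natr_residueB b c n_gt1 0%N) sub0r E opprK.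
case: (eqVneq v 0%N) => [v0|/eqP vN0] /=; last by apply/negP => /v0P.
have yu : y = u%:R by rewrite -yE v0 mul0r addr0.
rewrite (case_ y u) // (case_ (- y) (residue (0 - u%:Z) n)) ?residue_lt //.
by rewrite resE yu.
Qed.

Hypothesis n_nonsquare : ~~ [exists m : 'I_n.+1, (m ^ 2)%N == n].

(** The bounds on n come from m being (n - 1) / 2 or (n + 1) / 2. The O(1) operations are the
    inverse of 2 and one inverse for each trial prime. *)
Definition qft_cost B (tr : seq op) : Prop :=
  exists q f H, [/\ (2 ^ q <= n <= 2 ^ q.+2)%N, powering_cost q f H &
    cost_le tr (3 * q + 6 * f + 12 * H + 24) (size (small_primes B)).+1
      (23 * q + 25 * H + 100 + trial_cost (small_primes B))].

Lemma qft_prog_spec B st : bounded n st -> qft_inputs st ->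
  wp n w (qft_prog B) st (fun st' tr =>
    reg st' rVerdict = verdict_code (qft B n b c) /\ qft_cost B tr).
Proof.
move=> bd inp; have [_ _ _ [_ _ N0]] := inp.
apply: wp_seq; apply: wp_mono (prepare_spec bd inp) => st1 tr1 e1.
case=> cs1 t1 s1 [m_even m_gt0 tyE] c1.
have bd1 := exec_bounded n_gt1 w_tape e1 bd.
have N1 : (reg st1 rNorm)%:R = - c%:R :> A by rewrite (exec_same_outside e1).1.
have [z1 o1 _ _ _] := cs1.
set ty := reg st1 rType in tyE; set m := reg st1 rM in m_even m_gt0 tyE.
apply: wp_seq.
apply: wp_mono (split_even_spec n_odd n_gt1 w_tape bd1 z1 o1 t1 m_gt0) => st2 tr2 e2.
rewrite -/m => -[mE s_odd kE c2]; set t := reg st2 rT in mE c2;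
  set s := reg st2 rM in mE s_odd kE.
have bd2 := exec_bounded n_gt1 w_tape e2 bd1; have out2 := exec_same_outside e2.
have cs2 := constants_same out2 isT cs1.
have t_gt0 : (0 < t)%N.
  by move: m_even; rewrite mE; case: (t) => //; rewrite mul1n s_odd.
set k := reg st2 rE in kE.
have sE : s = (2 * k).+1 by rewrite kE mul2n -[LHS]odd_double_half s_odd.
rewrite {}sE in mE.
have mn : (2 * (2 ^ t * (2 * k).+1) <= n.+1)%N.
  by rewrite -mE; move: tyE; case: ifP => _; clear; lia.
apply: wp_seq.
apply: wp_mono (power_spec bd2 cs2 (erefl _) (erefl _) t_gt0 mn) => st3 tr3 e3.
rewrite -/k -/t -mE => -[rep3 [q [f [H [qm tq pc c3]]]]].
have bd3 := exec_bounded n_gt1 w_tape e3 bd2; have out3 := exec_same_outside e3.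
have cs3 := constants_same out3 isT cs2.
have t3 : reg st3 rT = t by rewrite out3.1.
have ty3 : reg st3 rType = ty by rewrite out3.1 // out2.1.
apply: wp_seq.
apply: wp_mono (climb_spec bd3 cs3 rep3 t3) => st4 tr4 e4 [].
rewrite ty3 -mE => rep4 Nk4 us4 fl4 c4.
have bd4 := exec_bounded n_gt1 w_tape e4 bd3; have out4 := exec_same_outside e4.
have cs4 := constants_same out4 isT cs3.
have ty4 : reg st4 rType = ty by rewrite out4.1.
apply: wp_seq.
apply: wp_mono (half_order_spec bd4 cs4 rep4 us4) => st5 tr5 e5 [].
rewrite ty4 => rep5 us5 c5.
have bd5 := exec_bounded n_gt1 w_tape e5 bd4; have out5 := exec_same_outside e5.
have cs5 := constants_same out5 isT cs4; have [z5 o5 _ _ _] := cs5.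
have fl5 : reg st5 rFlag = [exists i : 'I_t, flag_test n b c ty (2 ^ i * (2 * k).+1)]
  :> nat.
  by rewrite out5.1.
have s5 : reg st5 rSmall = false :> nat by rewrite !(out5.1, out4.1, out3.1, out2.1).
have N5 : (reg st5 rNorm)%:R = - c%:R :> A.
  by rewrite !(out5.1, out4.1, out3.1, out2.1).
have Nk5 : (reg st5 rNk)%:R = (- c%:R) ^+ k :> A by rewrite out5.1.
have primes_all : all prime (small_primes B) by rewrite filter_all.
apply: wp_seq.
apply: wp_mono (trial_division_spec n_gt1 w_tape bd5 z5 o5 s5 primes_all) => st6 tr6
  e6 [].
rewrite -small_factorE /= => s6 c6.
have bd6 := exec_bounded n_gt1 w_tape e6 bd5; have out6 := exec_same_outside e6.
have keep r : r \notin [:: rNeg; rA; rE; rSmall] -> reg st6 r = reg st5 r.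
  by move=> rn; apply: out6.1; apply: written_trial_division.
have z6 : reg st6 rZero = 0%N by rewrite keep.
have o6 : reg st6 rOne = 1%N by rewrite keep.
apply: wp_mono (decide_spec w n_gt1 bd6 z6 o6) => st7 tr7 e7.
rewrite s6 !keep // => -[-> c7]; split; last first.
  exists q, f, H; split=> //.
    move: qm tyE mE; rewrite !expnS; clear => /andP[]; case: ifP => _; lia.
  by move: c1 c2 c3 c4 c5 c6 c7 tq; clear; move: (trial_cost _) (size _) => ? ?; costs.
have half_n : n.+1./2 = if ty == 0%N then m.+1 else m.
  by move: tyE; clear; case: ifP => _; lia.
rewrite -half_n in rep5.
have U5 := bd5.1 rU; have V5 := bd5.1 rV.
(* From here on the verdict in coordinates is matched clause by clause with the tests made by
   [decide]. *)
rewrite (qft_split B n_odd n_gt1 n_nonsquare U5 V5 rep5).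
case: small_factor => //=.
case: eqP => //= v0.
have U2 : (((reg st5 rU * reg st5 rU) %% n)%N == reg st5 rNorm) =
    ((reg st5 rU)%:R * (reg st5 rU)%:R == - c%:R :> A).
  rewrite -N5 -natrM -(natr_mod n0); apply/eqP/eqP => [-> //|].
  by apply: (natr_inj n_odd basis); rewrite ?ltn_mod ?bd5.1 // ltnW.
rewrite U2; case: eqP => //= aa.
have xa : x ^+ n.+1./2 = (reg st5 rU)%:R.
  by have [<- _ _] := rep5; rewrite v0 mul0r addr0.
have eE : ((reg st5 rU * reg st5 rNk) %% n)%N%:R = (reg st5 rU)%:R * (- c%:R) ^+ k :> A.
  by rewrite (natr_mod n0) natrM Nk5.
rewrite -(half_power_eq _ (bd5.1 rUs) (bd5.1 rVs) us5); last by rewrite ltn_mod ltnW.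
rewrite eE fl5 eqb1; move: tyE; rewrite /flag_test; case: ifP => ty0 nE.
  rewrite (qft_final1 n_odd n_gt1 nE mE t_gt0 xa aa) orbC -orbA.
  by case: (_ || _).
rewrite (qft_final3 n_odd n_gt1 c_coprime nE mE t_gt0 xa aa) orbC -orbA.
by case: (_ || _).
Qed.

End Qft.

(** The constants are reloaded for every pair, so a new draw presupposes nothing about what the
    registers held before. *)
Definition draw : prog := Seq
  (instrs [:: Const rZero 0; Const rOne 1; Sub rMinusOne rZero rOne; Rand rB;
              Rand rC; Sub rNorm rZero rC])
  (Seq (instrs [:: Mul rDisc rB rB; Add rA rC rC; Add rA rA rA; Add rDisc rDisc rA])
  (Seq (instrs [:: Jac rA rDisc; Jac rE rNorm])
       (instrs [:: Inv rM rDisc; Inv rT rB; Inv rL rC]))).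

Definition composite : prog := instrs [:: Const rVerdict 0].

(** Since 1 <= b, c < n, a vanishing inverse of b or c means a nontrivial gcd. The discriminant can
    be 0 modulo n, with the trivial gcd n, so it is first compared with 0. *)
Definition reveal (p : prog) : prog :=
  let q := If (TestEq rT rZero) composite (If (TestEq rL rZero) composite p) in
  If (TestEq rDisc rZero) q (If (TestEq rM rZero) composite q).

Fixpoint search_prog (B k : nat) : prog :=
  if k is k'.+1 then
    Seq draw (If (TestEq rA rMinusOne)
      (If (TestEq rE rOne) (qft_prog B) (reveal (search_prog B k')))
      (reveal (search_prog B k')))
  else instrs [:: Const rVerdict 1].

Lemma residue_mod z n : (0 < n)%N -> (residue z n)%:Z = (z %% n%:Z)%Z.
Proof. by move=> n_gt0; rewrite /residue gez0_abs // modz_ge0 // eqz_nat -lt0n. Qed.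

Lemma residue1 n : (1 < n)%N -> residue 1 n = 1%N.
Proof. by move=> n_gt1; rewrite /residue modz_small. Qed.

Lemma residueN1 n : (1 < n)%N -> residue (-1) n = n.-1.
Proof.
move=> n_gt1; rewrite /residue -(modzDr (-1)) modz_small; last by lia.
by lia.
Qed.

(** For n > 2 the residues of -1, 0 and 1 are distinct, so the value of a Jacobi symbol can be read
    off from its residue. *)
Lemma residue_signN1 j n : (2 < n)%N -> j \in [:: -1; 0; 1] ->
  (residue j n == n.-1) = (j == -1).
Proof.
move=> n_gt2; have n_gt1 := ltnW n_gt2.
rewrite !inE => /or3P[]/eqP->; rewrite ?residueN1 ?residue1 ?eqxx //; last by lia.
by rewrite /residue mod0z; lia.
Qed.

Lemma residue_sign1 j n : (2 < n)%N -> j \in [:: -1; 0; 1] ->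
  (residue j n == 1%N) = (j == 1).
Proof.
move=> n_gt2; have n_gt1 := ltnW n_gt2.
rewrite !inE => /or3P[]/eqP->; rewrite ?residueN1 ?residue1 ?eqxx //; first by lia.
by rewrite /residue mod0z.
Qed.

Lemma nontrivial_gcdE n a : (1 < n)%N ->
  nontrivial_gcd n a = ((a %% n)%N != 0%N) && (inv_mod n (a %% n) == 0%N).
Proof.
move=> n_gt1; rewrite inv_mod_eq0 // /nontrivial_gcd -(gcdn_modl a n) /coprime.
case: eqVneq => [->|r0] /=; first by rewrite gcd0n ltnn andbF.
have r_gt0 : (0 < a %% n)%N by rewrite lt0n.
have g_le : (gcdn (a %% n) n < n)%N.
  by rewrite (leq_ltn_trans (dvdn_leq r_gt0 (dvdn_gcdl _ _))) // ltn_mod ltnW.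
have : (0 < gcdn (a %% n) n)%N by rewrite gcdn_gt0 r_gt0.
by rewrite g_le andbT; lia.
Qed.

(** The test proper runs at most once: [m] and [a] account for it and are 0 if the search ends
    otherwise. The terms [20 * k] cover the draws. *)
Definition search_cost (B n k : nat) (tr : seq op) : Prop :=
  exists m a, (m = 0%N /\ a = 0%N \/
    exists q f H, [/\ (2 ^ q <= n <= 2 ^ q.+2)%N, powering_cost q f H,
      m = (3 * q + 6 * f + 12 * H + 24)%N &
      a = (23 * q + 25 * H + 100 + trial_cost (small_primes B))%N]) /\
  cost_le tr (m + 20 * k) ((size (small_primes B)).+1 + 20 * k) (a + 20 * k + 1).

(** * The search for admissible parameters *)

Section Search.
Variables (n : nat) (w : nat -> nat).
Hypotheses (n_odd : odd n) (n_gt1 : (1 < n)%N) (w_tape : random_tape n w).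

(** The number of tests passed before [p] starts depends on the branch, hence the quantification
    over prefixes [tr0]. *)
Lemma wp_reveal p st (Q : state -> seq op -> Prop) :
  bounded n st -> reg st rZero = 0%N ->
  let r := [|| (reg st rDisc != 0%N) && (reg st rM == 0%N), reg st rT == 0%N |
               reg st rL == 0%N] in
  (r -> forall st' tr, reg st' rVerdict = 0%N -> cost_le tr 0 0 5 -> Q st' tr) ->
  (~~ r -> wp n w p st (fun st' tr => forall tr0, cost_le tr0 0 0 4 -> Q st' (tr0 ++
    tr))) ->
  wp n w (reveal p) st Q.
Proof.
move=> bd z0 r yes no.
have comp (Q' : state -> seq op -> Prop) :
    (forall st', reg st' rVerdict = 0%N -> Q' st' [:: OpAdd]) -> wp n w composite st Q'.
  by move=> h; apply: wp_instrs; apply: h; rewrite /= /update /= mod0n.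
have tail (Q' : state -> seq op -> Prop) :
    ((reg st rT == 0%N) || (reg st rL == 0%N) -> forall st' tr,
       reg st' rVerdict = 0%N -> cost_le tr 0 0 3 -> Q' st' tr) ->
    (~~ ((reg st rT == 0%N) || (reg st rL == 0%N)) ->
       wp n w p st (fun st' tr => Q' st' [:: OpAdd, OpAdd & tr])) ->
    wp n w (If (TestEq rT rZero) composite (If (TestEq rL rZero) composite p)) st Q'.
  move=> yes' no'; apply: wp_if; rewrite {1}/run_test z0 => tT.
    by apply: comp => st' v0; apply: yes'; rewrite ?tT.
  apply: wp_if; rewrite {1}/run_test z0 => tL.
    by apply: comp => st' v0; apply: yes'; rewrite ?tL ?orbT.
  by apply: no'; rewrite tT tL.
apply: wp_if; rewrite {1}/run_test z0 => tD.
  apply: tail => [h st' tr v0 c0|h].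
    by apply: yes; [rewrite /r h orbT | done | move: c0; clear; costs].
  have := no; rewrite /r tD (negPf h) => /(_ isT).
  by apply: wp_mono => st' tr _ h'; apply: (h' [:: OpAdd; OpAdd; OpAdd]).
apply: wp_if; rewrite {1}/run_test z0 => tM.
  by apply: comp => st' v0; apply: yes; rewrite /r ?tD ?tM.
apply: tail => [h st' tr v0 c0|h].
  by apply: yes; [rewrite /r h orbT | done | move: c0; clear; costs].
have := no; rewrite /r tM andbF (negPf h) => /(_ isT).
by apply: wp_mono => st' tr _ h'; apply: (h' [:: OpAdd; OpAdd; OpAdd; OpAdd]).
Qed.

Definition drawn b c st : Prop :=
  [/\ reg st rZero = 0%N, reg st rOne = 1%N, reg st rMinusOne = n.-1, reg st rB = b &
   [/\ reg st rDisc = ((b ^ 2 + 4 * c) %% n)%N, reg st rNorm = residue (0%N%:Z -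
     c%:Z) n,
       reg st rA = residue (jacobi_symbol (b ^ 2 + 4 * c)%N%:Z n) n,
       reg st rE = residue (jacobi_symbol (- c%:Z) n) n &
   [/\ reg st rM = inv_mod n (reg st rDisc), reg st rT = inv_mod n b &
       reg st rL = inv_mod n c]]].

Lemma draw_spec st :
  wp n w draw st (fun st' tr =>
    [/\ drawn (w (pos st)) (w (pos st).+1) st', pos st' = (pos st).+2 &
        cost_le tr 1 7 7]).
Proof.
set b := w (pos st); set c := w (pos st).+1.
apply: wp_seq; apply: wp_instrs; set st1 := run_instrs _ _ _ _.
have z1 : reg st1 rZero = 0%N by rewrite /st1 /= /update /= mod0n.
have o1 : reg st1 rOne = 1%N by rewrite /st1 /= /update /= modn_small.
have B1 : reg st1 rB = b by [].
have C1 : reg st1 rC = c by [].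
have N1 : reg st1 rNorm = residue (0%N%:Z - c%:Z) n by rewrite /st1 /= /update /= mod0n.
have m1 : reg st1 rMinusOne = n.-1.
  by rewrite /st1 /= /update /= mod0n (modn_small n_gt1) -[RHS]residueN1.
have p1 : pos st1 = (pos st).+2 by [].
clearbody st1.
apply: wp_seq; apply: wp_instrs; set st2 := run_instrs _ _ _ _.
have D2 : reg st2 rDisc = ((b ^ 2 + 4 * c) %% n)%N.
  rewrite /st2 /= /update /= B1 C1 !modnDm -mulnn -modnDmr modnDm modnDmr.
  by congr (modn _ n); clear; lia.
have [z2 o2 m2] : [/\ reg st2 rZero = 0%N, reg st2 rOne = 1%N & reg st2 rMinusOne =
  n.-1].
  by rewrite !run_instrs_reg.
have [N2 B2 C2] : [/\ reg st2 rNorm = residue (0%N%:Z - c%:Z) n, reg st2 rB = b & reg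
  st2 rC = c].
  by rewrite !run_instrs_reg.
have p2 : pos st2 = (pos st).+2 by rewrite -p1.
clearbody st2.
apply: wp_seq; apply: wp_instrs; set st3 := run_instrs _ _ _ _.
have J1 : reg st3 rA = residue (jacobi_symbol (b ^ 2 + 4 * c)%N%:Z n) n.
  rewrite /st3 /= /update /= D2; congr (residue _ n); apply: jacobi_symbol_mod.
  by rewrite !modz_nat modn_mod.
have J2 : reg st3 rE = residue (jacobi_symbol (- c%:Z) n) n.
  rewrite /st3 /= /update /= N2; congr (residue _ n); apply: jacobi_symbol_mod.
  by rewrite residue_mod 1?ltnW // modz_mod sub0r.
have {D2} D3 : reg st3 rDisc = ((b ^ 2 + 4 * c) %% n)%N by rewrite run_instrs_reg.
have [z3 o3 m3] : [/\ reg st3 rZero = 0%N, reg st3 rOne = 1%N & reg st3 rMinusOne =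
  n.-1].
  by rewrite !run_instrs_reg.
have [N3 B3 C3] : [/\ reg st3 rNorm = residue (0%N%:Z - c%:Z) n, reg st3 rB = b & reg
  st3 rC = c].
  by rewrite !run_instrs_reg.
have p3 : pos st3 = (pos st).+2 by rewrite -p2.
clearbody st3.
apply: wp_instrs; set st4 := run_instrs _ _ _ _; split; [| by rewrite -p3 | by split].
have M4 : reg st4 rM = inv_mod n (reg st3 rDisc) by rewrite /st4 /= /update.
have T4 : reg st4 rT = inv_mod n (reg st3 rB) by rewrite /st4 /= /update.
have L4 : reg st4 rL = inv_mod n (reg st3 rC) by rewrite /st4 /= /update.
have keep r : r \notin [:: rM; rT; rL] -> reg st4 r = reg st3 r.
  by move=> rn; rewrite run_instrs_reg.
clearbody st4; rewrite /drawn M4 T4 L4 !keep //.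
by rewrite B3 C3.
Qed.

Lemma search_spec B k i st : bounded n st -> pos st = (2 * i)%N ->
  wp n w (search_prog B k) st (fun st' tr =>
    reg st' rVerdict = verdict_code (rqft_search B n w k i) /\ search_cost B n k tr).
Proof.
have n_gt2 : (2 < n)%N by move: n_odd n_gt1; clear; lia.
elim: k i st => [|k IH] i st bd posE.
  apply: wp_instrs; rewrite /= /update /= modn_small //; split=> //.
  by exists 0%N, 0%N; split; [left | split].
apply: wp_seq; apply: wp_mono (draw_spec st) => st1 tr1 e1.
rewrite [rqft_search _ _ _ _ _]/= posE; set b := w (2 * i)%N; set c := w (2 * i).+1.
have /andP[b_gt0 bn] : (1 <= b < n)%N := w_tape _.
have /andP[c_gt0 cn] : (1 <= c < n)%N := w_tape _.
have bd1 := exec_bounded n_gt1 w_tape e1 bd.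
move=> [[z1 o1 m1 B1 [D1 N1 J1 J2 [M1 T1 L1]]] p1 c1].
have {}p1 : pos st1 = (2 * i.+1)%N by rewrite p1 mulnS.
have bE : nontrivial_gcd n b = (reg st1 rT == 0%N).
  by rewrite nontrivial_gcdE // (modn_small bn) -lt0n b_gt0 T1.
have cE : nontrivial_gcd n c = (reg st1 rL == 0%N).
  by rewrite nontrivial_gcdE // (modn_small cn) -lt0n c_gt0 L1.
have rE' : reveals_factor n b c = [|| (reg st1 rDisc != 0%N) && (reg st1 rM == 0%N),
    reg st1 rT == 0%N | reg st1 rL == 0%N].
  by rewrite /reveals_factor bE cE nontrivial_gcdE // M1 D1.
(* Both ways of failing admissibility lead here; [a0] stands for the one or two tests made
   before. *)
have other a0 : cost_le a0 0 0 2 ->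
    wp n w (reveal (search_prog B k)) st1 (fun st' tr =>
      reg st' rVerdict = verdict_code (if reveals_factor n b c then Composite
        else rqft_search B n w k i.+1) /\ search_cost B n k.+1 (tr1 ++ a0 ++ tr)).
  move=> c0; apply: wp_reveal => //; rewrite -rE'.
    move=> -> st' tr -> ctr; split=> //; exists 0%N, 0%N; split; first by left.
    by move: c1 c0 ctr; clear; move: (size _) => ?; costs.
  move=> /negPf ->; apply: wp_mono (IH i.+1 st1 bd1 p1) => st' tr _.
  move=> [-> [m [a [ma ctr]]]] tr0 ctr0; split=> //; exists m, a; split=> //.
  by move: c1 c0 ctr ctr0; clear; move: (size _) => ?; costs.
rewrite /qft_admissible.
apply: wp_if; rewrite {1}/run_test J1 m1 residue_signN1 ?jacobi_symbol_val // => jD;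
  rewrite jD /=.
  apply: wp_if; rewrite {1}/run_test J2 o1 residue_sign1 ?jacobi_symbol_val // => jN;
    rewrite jN /=.
    (* Admissibility supplies the hypotheses of the test: symbol 1 of -c makes c prime to n, and
       symbol -1 of the discriminant excludes squares. *)
    have c_co : coprime c n.
      have := @jacobi_symbol_coprime (- c%:Z) n (ltnW n_gt1).
      by rewrite (eqP jN) abszN => /(_ isT).
    have inp : qft_inputs n b c st1.
      split=> //; split=> //.
        by rewrite D1 natr_mod //; apply: qft_natr0.
      by rewrite N1 (natr_residueB b c n_gt1 0%N) sub0r.
    have nsq := jacobi_symbolN1_nonsquare (eqP jD).
    apply: wp_mono (qft_prog_spec n_odd n_gt1 w_tape c_co nsq B bd1 inp) => st' tr _.
    move=> [-> [q [f [H [qn pc ctr]]]]]; split=> //.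
    eexists; eexists; split; first by right; exists q, f, H; split.
    by move: c1 ctr; clear; move: (size _) (trial_cost _) => ? ?; costs.
  by apply: (other [:: OpAdd; OpAdd]).
by apply: (other [:: OpAdd]).
Qed.

End Search.

(** * Running time *)

(** A lower bound for the number of digits between two flushes. The successor makes it positive,
    hence a legitimate divisor. *)
Definition log_log_log (n : nat) : nat :=
  (trunc_log 2 (trunc_log 2 (trunc_log 2 n))).+1.

Lemma leq_trunc_log_id m : (trunc_log 2 m <= m)%N.
Proof.
by case: m => // m; apply/ltnW/(leq_trans (ltn_expl _ (ltnSn 1)))/trunc_logP.
Qed.

Lemma log_log_log_le n : (1 < n)%N -> (log_log_log n <= trunc_log 2 n)%N.
Proof.
move=> n_gt1; have l_gt0 : (0 < trunc_log 2 n)%N by rewrite trunc_log_gt0.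
apply: leq_ltn_trans (leq_trunc_log_id _) _.
by apply: leq_trans (ltn_expl _ (ltnSn 1)) (trunc_logP _ l_gt0).
Qed.

Lemma log_log_log_ge N n : (2 ^ 2 ^ 2 ^ N <= n)%N -> (N < log_log_log n)%N.
Proof. by move=> h; rewrite ltnS; do 3!apply: trunc_log_max => //. Qed.

(** Since 2^(H - 2) < q, this yields H^2 <= 16 q, so building the table is of lower order. *)
Lemma square_le_expn H : (H ^ 2 <= 4 * 2 ^ H)%N.
Proof.
have [|] := ltnP H 4; first by do 4?[case: H => [|H] //].
elim: H => // H IH; rewrite ltnS leq_eqVlt => /predU1P[<- //|H_ge].
have := IH H_ge; rewrite expnS (expnS 2 H) -!mulnn; nia.
Qed.

(** Both [f] and [H] are O(log n / log log log n); the products avoid division of natural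
    numbers. *)
Lemma powering_cost_bounds n q f H : (1 < n)%N -> (2 ^ q <= n <= 2 ^ q.+2)%N ->
  powering_cost q f H ->
  [/\ (q <= trunc_log 2 n)%N, (log_log_log n * f <= trunc_log 2 n)%N,
      (log_log_log n * H <= 16 * trunc_log 2 n)%N & (H <= trunc_log 2 n)%N].
Proof.
move=> n_gt1 /andP[qn nq] [qH Hq /andP[H_gt0 Hq'] ff].
have q_le : (q <= trunc_log 2 n)%N by apply: trunc_log_max.
have ln_le : (trunc_log 2 n <= q.+2)%N by rewrite -(trunc_expnK q.+2 (ltnSn 1))
  leq_trunc_log.
(* Because log2 n is at most q + 2, and q + 2 <= 2^(H - 1) + 2 < 2^(H + 1). *)
have lln_le : (trunc_log 2 (trunc_log 2 n) <= H)%N.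
  rewrite -ltnS -(@ltn_exp2l 2) //; apply: leq_ltn_trans (trunc_logP _ _) _ => //.
    by rewrite trunc_log_gt0.
  apply: (leq_ltn_trans ln_le); rewrite -(prednK H_gt0) !expnS.
  have : (0 < 2 ^ H.-1)%N by rewrite expn_gt0.
  by move: qH; clear; lia.
have g_le : (log_log_log n <= (trunc_log 2 H).+1)%N by rewrite ltnS leq_trunc_log.
have G_le : ((trunc_log 2 H).+1 <= H)%N.
  by apply: leq_trans (ltn_expl _ (ltnSn 1)) (trunc_logP _ H_gt0).
have H2 : (H ^ 2 <= 16 * q)%N.
  have [H1|H_gt1] := leqP H 1; first by move: H1 Hq'; clear; case: H => [|[]] //; lia.
  apply: leq_trans (square_le_expn H) _.
  have q1 : (0 < q.-1)%N by move: H_gt1 Hq'; clear; lia.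
  have := Hq q1; rewrite -(prednK H_gt0) -{2}(prednK (n := H.-1)); last by move: H_gt1;
    clear; lia.
  by rewrite /= !expnS; clear; lia.
split=> //.
- by apply: leq_trans q_le; apply: leq_trans ff; rewrite mulnC leq_mul2l g_le orbT.
- apply: leq_trans (_ : H ^ 2 <= _)%N; last by apply: (leq_trans H2); rewrite leq_mul2l.
  by rewrite -mulnn leq_mul2r (leq_trans g_le) ?orbT.
- exact: leq_trans Hq' q_le.
Qed.

Lemma search_cost_bounds B n tr : (1 < n)%N -> search_cost B n B tr ->
  let C := (1000 + 40 * B + size (small_primes B) + trial_cost (small_primes B))%N in
  [/\ (log_log_log n * muls tr <= (3 * log_log_log n + C) * trunc_log 2 n)%N,
      (calls tr <= C)%N & (adds tr <= C * trunc_log 2 n)%N].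
Proof.
move=> n_gt1 [m [a [ma [h1 h2 h3]]]] C.
have l_gt0 : (0 < trunc_log 2 n)%N by rewrite trunc_log_gt0.
have gl := log_log_log_le n_gt1.
have -> : (calls tr <= C)%N by apply: (leq_trans h2); rewrite /C; clear; lia.
set l := trunc_log 2 n in l_gt0 gl *; set g := log_log_log n in gl *.
have [m_le a_le] : (g * m <= (3 * g + 300) * l)%N /\ (a <= (200 + trial_cost
  (small_primes B)) * l)%N.
  case: ma => [[-> ->]|[q [f [H [qn pc -> ->]]]]]; first by rewrite muln0.
  have [b1 b2 b3 b4] := powering_cost_bounds n_gt1 qn pc.
  rewrite -/l -/g in b1 b2 b3 b4; split.
    rewrite !mulnDr !mulnDl; have : (g * q <= g * l)%N by rewrite leq_mul2l b1 orbT.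
    by move: b2 b3 gl; clear; nia.
  by move: b1 b4 l_gt0; move: (trial_cost _); clear; nia.
split=> //.
  apply: (@leq_trans (g * (m + 20 * B))%N); first by rewrite leq_mul2l h1 orbT.
  rewrite mulnDr; apply: (@leq_trans ((3 * g + 300) * l + 20 * B * l)%N).
    by rewrite leq_add // mulnC leq_mul2l gl orbT.
  by rewrite -mulnDl leq_mul2r /C; apply/orP; right; clear; lia.
apply: leq_trans h3 _;
  apply: (@leq_trans ((200 + trial_cost (small_primes B)) * l + (20 * B + 1) * l)%N).
  by rewrite -addnA leq_add // -{1}(muln1 (_ + 1)%N) leq_mul2l l_gt0 orbT.
by rewrite -mulnDl leq_mul2r /C; apply/orP; right; clear; lia.
Qed.

Lemma trunc_log_le_log2 (R : realType) n : (0 < n)%N -> (trunc_log 2 n)%:R <= log2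
  (n%:R : R).
Proof.
move=> n_gt0; rewrite /log2 ler_pdivlMr ?ln_gt0 ?ltr1n //.
have h : ((2 ^ trunc_log 2 n)%N%:R : R) <= n%:R by rewrite ler_nat trunc_logP.
rewrite mulrC mulr_natr -lnXn ?ltr0n // -natrX.
by rewrite ler_ln ?posrE ?ltr0n ?expn_gt0.
Qed.

(** * The o(1) term *)

Section Asymptotics.
Local Open Scope classical_set_scope.
Local Open Scope ring_scope.
Variables (R : realType) (price : op -> nat -> R).
Hypothesis price_model : cost_model price.

Definition call_price n : R := price OpInv n + price OpJac n + price OpRand n.

Lemma cost_le_counts n tr :
  cost price n tr <=
    (muls tr)%:R + (calls tr)%:R * call_price n + (adds tr)%:R * price OpAdd n.
Proof.
have [p_ge0 p_mul _ _ _] := price_model.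
rewrite /cost; elim: tr => [|o tr IH]; first by rewrite big_nil !mul0r !addr0.
rewrite big_cons /muls /calls /adds /= !natrD.
apply: le_trans (lerD (lexx _) IH) _.
have := p_ge0 OpInv n; have := p_ge0 OpJac n; have := p_ge0 OpRand n;
  have := p_ge0 OpAdd n.
rewrite /call_price -/(muls tr) -/(calls tr) -/(adds tr) {IH}.
by case: o => /=; rewrite ?p_mul; lra.
Qed.

(** The quotient pays for the multiplications beyond 3 log2 n and for the boundedly many calls; the
    last term pays for O(log n) operations of price o(1). *)
Definition slack (C : nat) (n : nat) : R^o :=
  C%:R * ((1 + call_price n) / (log_log_log n)%:R + price OpAdd n).

Lemma slack_littleo C : slack C =o_\oo (fun=> 1 : R^o).
Proof.
have [p_ge0 _ /eqO_exP[kI kI_gt0 hI] /eqO_exP[kJ kJ_gt0 hJ] [/eqO_exP[kR kR_gt0 hR]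
  /eqoP pA]] :=
  price_model.
apply/eqoP => eps eps_gt0.
have C1_gt0 : 0 < C%:R + 1 :> R by rewrite ltr_wpDl.
(* [C%:R + 1] in place of [C%:R] avoids a division by zero when C = 0. *)
have d_gt0 : 0 < eps / (2 * (C%:R + 1)) by rewrite divr_gt0 // mulr_gt0.
have {pA} hA := pA _ d_gt0.
(* Chosen so that the quotient in [slack] is at most eps / 2 once [log_log_log n] exceeds [M]. *)
set M : R := (C%:R * (1 + (kI + kJ + kR)) * 2) / eps.
have M_ge0 : 0 <= M by rewrite !mulr_ge0 ?invr_ge0 ?addr_ge0 // ltW.
near=> n.
have eI : `|price OpInv n| <= kI * `|1 : R| by near: n.
have eJ : `|price OpJac n| <= kJ * `|1 : R| by near: n.
have eR : `|price OpRand n| <= kR * `|1 : R| by near: n.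
have eA : `|price OpAdd n| <= eps / (2 * (C%:R + 1)) * `|1 : R| by near: n.
have hn : (2 ^ 2 ^ 2 ^ Num.bound M <= n)%N by near: n; apply: nbhs_infty_ge.
rewrite normr1 !mulr1 !ger0_norm // in eI eJ eR eA.
rewrite normr1 mulr1.
have call_ge0 : 0 <= call_price n by rewrite /call_price !addr_ge0.
have g_gt0 : 0 < (log_log_log n)%:R :> R by rewrite ltr0n.
have call_le : call_price n <= kI + kJ + kR by rewrite /call_price !lerD.
have M_lt : M < (log_log_log n)%:R.
  apply: lt_le_trans (archi_boundP M_ge0) _; rewrite ler_nat ltnW //.
  exact: log_log_log_ge.
rewrite ger0_norm; last first.
  by rewrite /slack mulr_ge0 // addr_ge0 // divr_ge0 ?addr_ge0 // ltW.
rewrite /slack mulrDr [eps]splitr lerD //.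
  rewrite mulrA ler_pdivrMr //.
  have : C%:R * (1 + (kI + kJ + kR)) <= eps / 2 * M.
    by rewrite /M le_eqVlt; apply/orP; left; apply/eqP; field; rewrite gt_eqF.
  move=> h; apply: le_trans (_ : C%:R * (1 + (kI + kJ + kR)) <= _);
    first by rewrite ler_wpM2l // lerD.
  by apply: (le_trans h); rewrite ler_wpM2l ?ltW // divr_gt0.
apply: le_trans (_ : (C%:R + 1) * (eps / (2 * (C%:R + 1))) <= _).
  by apply: ler_pM => //; rewrite lerDl.
by rewrite le_eqVlt; apply/orP; left; apply/eqP; field; rewrite gt_eqF.
Unshelve. all: by end_near. Qed.

Lemma cost_le_selfridges C n tr : (1 < n)%N ->
  (log_log_log n * muls tr <= (3 * log_log_log n + C) * trunc_log 2 n)%N ->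
  (calls tr <= C)%N -> (adds tr <= C * trunc_log 2 n)%N ->
  cost price n tr <= (3 + slack C n) * log2 n%:R.
Proof.
move=> n_gt1 hm hc ha; have [p_ge0 _ _ _ _] := price_model.
have call_ge0 : 0 <= call_price n by rewrite /call_price !addr_ge0.
have g_gt0 : 0 < (log_log_log n)%:R :> R by rewrite ltr0n.
have slack_ge0 : 0 <= slack C n.
  by rewrite /slack mulr_ge0 // addr_ge0 // divr_ge0 ?addr_ge0 // ltW.
apply: le_trans (cost_le_counts n tr) _.
apply: le_trans (_ : (3 + slack C n) * (trunc_log 2 n)%:R <= _); last first.
  by rewrite ler_wpM2l ?addr_ge0 // trunc_log_le_log2 // ltnW.
set l : R := (trunc_log 2 n)%:R; set g : R := (log_log_log n)%:R in g_gt0 *.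
have m_le : (muls tr)%:R <= 3 * l + C%:R * l / g.
  rewrite -(ler_pM2l g_gt0) mulrDr [X in _ + X](_ : _ = C%:R * l); last first.
    by rewrite mulrC divfK // gt_eqF.
  have := hm; rewrite -(ler_nat R) !natrM natrD natrM -/l -/g => /le_trans; apply.
  by rewrite le_eqVlt; apply/orP; left; apply/eqP; ring.
(* A constant number of calls is absorbed through g <= l, that is [log_log_log_le]. *)
have c_le : (calls tr)%:R * call_price n <= C%:R * call_price n * l / g.
  rewrite ler_pdivlMr // mulrAC [leRHS]mulrAC ler_wpM2r // -!natrM ler_nat.
  by rewrite leq_mul // log_log_log_le.
have a_le : (adds tr)%:R * price OpAdd n <= C%:R * l * price OpAdd n.
  by rewrite ler_wpM2r // -natrM ler_nat.
apply: le_trans (lerD (lerD m_le c_le) a_le) _.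
rewrite /slack -/g le_eqVlt; apply/orP; left; apply/eqP; field.
by rewrite gt_eqF.
Qed.

End Asymptotics.

Theorem theorem3p4 (R : realType) (price : op -> nat -> R)
    (price_model : cost_model price) (B : nat) (B_gt0 : (0 < B)%N) :
  at_most_selfridges price (rqft B) 3.
Proof.
have init_bounded n : (1 < n)%N -> bounded n init_state.
  by move=> n_gt1; split=> *; apply: ltnW.
(* One [B] bounds the trial division, the other is the number of pairs. *)
exists (search_prog B B).
  move=> n w n_odd n_gt1 w_tape.
  have [tr [st [e [verdict_eq _]]]] :=
    search_spec n_odd n_gt1 w_tape B B (i := 0) (init_bounded n n_gt1) (erefl _).
  by exists tr, st.
exists (slack price (1000 + 40 * B + size (small_primes B) +
  trial_cost (small_primes B))).
  exact: slack_littleo.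
move=> n w tr st n_odd n_gt1 w_tape e.
have [tr' [st' [e' [_ c]]]] :=
  search_spec n_odd n_gt1 w_tape B B (i := 0) (init_bounded n n_gt1) (erefl _).
have [-> _] := exec_det e e'.
by have [] := search_cost_bounds n_gt1 c; apply: cost_le_selfridges.
Qed.
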